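(* Let $\boldsymbol{f}\in[L^2(\Omega)]^d$ and let $(\boldsymbol{u}_h,p_h)\in V_h\times W_h$ be a solution of the discrete Stokes problem $$\nu a_h(\boldsymbol{u}_h,\boldsymbol{v}_h)-b(\boldsymbol{v}_h,p_h)=(\boldsymbol{f},\boldsymbol{v}_h)\quad\forall\,\boldsymbol{v}_h\in V_h,\qquad b(\boldsymbol{u}_h,q_h)=0\quad\forall\, q_h\in W_h,$$ where $V_h=V_h^1\oplus RT0$ and $a^R$ (entering $a_h$) is any of the three choices $a^0,a^D,a^{\operatorname{div}}$. Then $\nabla\cdot\boldsymbol{u}_h\equiv 0$ in $\Omega$.
   Context: $\Omega\subset\mathbb{R}^d$ ($d=2,3$) is a bounded domain with Lipschitz polygonal/polyhedral boundary $\Gamma$; $\nu>0$ is a constant; $(\cdot,\cdot)$, $(\cdot,\cdot)_T$ are the $L^2$ inner products on $\Omega$, $T$. $\mathcal{T}_h$ is a shape-regular conforming triangulation of $\Omega$ into triangles/tetrahedra; $h_T$ is the diameter of $T$; $\mathcal{E}^0$ is the set of interior faces. Spaces: $V=[H_0^1(\Omega)]^d$, $W=L_0^2(\Omega)$ (zero-mean $L^2$ functions), $V_h^1=\{\boldsymbol{v}\in V:\boldsymbol{v}|_T\in[P_1(T)]^d\ \forall T\in\mathcal{T}_h\}$, $RT0=\{\boldsymbol{v}\in H_0(\operatorname{div};\Omega):\boldsymbol{v}|_T\in[P_0(T)]^d\oplus\boldsymbol{x}P_0(T)\ \forall T\in\mathcal{T}_h\}$, $W_h=\{q\in L_0^2(\Omega):q|_T\in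 P_0(T)\ \forall T\in\mathcal{T}_h\}$, where $H_0(\operatorname{div};\Omega)$ is the space of $\boldsymbol v\in [L^2(\Omega)]^d$ with $\nabla\cdot\boldsymbol v\in L^2(\Omega)$ and $\boldsymbol v\cdot\boldsymbol n|_\Gamma=0$. One has $V_h^1\cap RT0=\{\boldsymbol 0\}$, and $V_h=V_h^1\oplus RT0$. For $e\in\mathcal{E}^0$, $\boldsymbol{\Phi}_e\in RT0$ is the usual basis function, supported on the two elements sharing $e$, with $\boldsymbol{\Phi}_e\cdot\boldsymbol{n}_{e'}=0$ on every face $e'\ne e$ (its nonzero normalization is immaterial). Each $\boldsymbol{v}_h\in V_h$ is uniquely written $\boldsymbol{v}_h=\boldsymbol{v}_h^1+\boldsymbol{v}_h^R$ with $\boldsymbol{v}_h^1\in V_h^1$, $\boldsymbol{v}_h^R=\sum_{e\in\mathcal{E}^0}v_e\boldsymbol{\Phi}_e\in RT0$. Forms: $a(\boldsymbol{u},\boldsymbol{v})=(\nabla\boldsymbol{u},\nabla\boldsymbol{v})$, $b(\boldsymbol{v},q)=(\nabla\cdot\boldsymbol{v},q)$, $a_h(\boldsymbol{u}_h,\boldsymbol{v}_h)=a(\boldsymbol{u}_h^1,\boldsymbol{v}_h^1)+a^R(\boldsymbol{u}_h^R,\boldsymbol{v}_h^R)$, where, with positive parameters $\alpha_T$ ($T\in\mathcal{T}_h$), $a^R$ is one of $a^0(\boldsymbol{u}^R,\boldsymbol{v}^R)=\sum_{T}\alpha_Th_T^{-2}(\boldsymbol{u}^R,\boldsymbol{v}^R)_T$,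 $a^D(\boldsymbol{u}^R,\boldsymbol{v}^R)=\sum_T\sum_{e\subset\partial T,\,e\in\mathcal{E}^0}\alpha_Th_T^{-2}u_ev_e(\boldsymbol{\Phi}_e,\boldsymbol{\Phi}_e)_T$, $a^{\operatorname{div}}(\boldsymbol{u}^R,\boldsymbol{v}^R)=\sum_T\sum_{e\subset\partial T,\,e\in\mathcal{E}^0}\alpha_Tu_ev_e(\nabla\cdot\boldsymbol{\Phi}_e,\nabla\cdot\boldsymbol{\Phi}_e)_T$. *)

(* Defs.v *)
From HB Require Import structures.
From mathcomp Require Import all_boot all_order all_algebra.
From mathcomp Require Import all_classical all_reals all_analysis.

Set Implicit Arguments.
Unset Strict Implicit.
Unset Printing Implicit Defensive.

Import Order.TTheory GRing.Theory Num.Theory.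
Import numFieldNormedType.Exports.

Local Open Scope classical_set_scope.
Local Open Scope ring_scope.

Definition rV_display : measure_display.
Proof. exact: default_measure_display. Qed.

(* The sigma-algebra generated by the coordinates, i.e., the Borel one. *)
Section measurable_rV.
Context (R : realType) (n : nat).

Definition rV_coord (i : 'I_n) (x : 'rV[R]_n) : R := x ord0 i.

Let m0 : g_sigma_preimage rV_coord set0.
Proof. exact: sigma_algebra0. Qed.

Let mC A : g_sigma_preimage rV_coord A -> g_sigma_preimage rV_coord (~` A).
Proof. exact: sigma_algebraC. Qed.

Let mU (F : _^nat) : (forall i, g_sigma_preimage rV_coord (F i)) ->
  g_sigma_preimage rV_coord (\bigcup_i (F i)).
Proof. exact: sigma_algebra_bigcup. Qed.

HB.instance Definition _ :=
  @isMeasurable.Build rV_display 'rV[R]_n (g_sigma_preimage rV_coord) m0 mC mU.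

Lemma measurable_rV_coord (i : 'I_n) :
  measurable_fun [set: 'rV[R]_n] (rV_coord i).
Proof.
move=> _ Y mY; rewrite setTI; apply: sub_sigma_algebra => /=.
rewrite -bigcup_seq/=; exists i => /=; first by rewrite mem_index_enum.
by exists Y => //; rewrite setTI.
Qed.

Lemma measurable_fun_rV d (T : measurableType d) (f : T -> 'rV[R]_n) :
  (forall i, measurable_fun [set: T] (fun x => f x ord0 i)) ->
  measurable_fun [set: T] f.
Proof.
move=> mf; suff H : g_sigma_preimage (fun i => rV_coord i \o f) `<=` measurable.
  by move=> _ A mA; apply: H; rewrite g_sigma_preimage_comp; exists A.
apply: smallest_sub; first exact: sigma_algebra_measurable.
move=> A; rewrite -bigcup_seq => -[i _ [B mB <-]].
by have := mf i measurableT B mB.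
Qed.

End measurable_rV.

Section lebesgue_rV.
Context (R : realType).

Definition rV_cons n (p : R * 'rV[R]_n) : 'rV[R]_n.+1 :=
  \row_i oapp (p.2 ord0) p.1 (unlift ord0 i).

Definition rV_uncons n (x : 'rV[R]_n.+1) : R * 'rV[R]_n :=
  (x ord0 ord0, \row_i x ord0 (lift ord0 i)).

Lemma rV_consK n : cancel (@rV_cons n) (@rV_uncons n).
Proof.
case=> a x; rewrite /rV_uncons /rV_cons !mxE unlift_none; congr pair.
by apply/rowP => i; rewrite !mxE liftK.
Qed.

Lemma measurable_rV_cons n : measurable_fun [set: R * 'rV[R]_n] (@rV_cons n).
Proof.
apply: measurable_fun_rV => i.
case: (unliftP ord0 i) => [j ->|->].
- rewrite (_ : (fun _ => _) = rV_coord j \o snd).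
    exact: (measurableT_comp (measurable_rV_coord j) measurable_snd).
  by apply/funext => p; rewrite /= mxE liftK.
- rewrite (_ : (fun _ => _) = fst); first exact: measurable_fst.
  by apply/funext => p; rewrite /= mxE unlift_none.
Qed.

Lemma measurable_rV_uncons n : measurable_fun [set: 'rV[R]_n.+1] (@rV_uncons n).
Proof.
apply: measurable_fun_pair; first exact: (measurable_rV_coord ord0).
apply: measurable_fun_rV => i.
rewrite (_ : (fun _ => _) = rV_coord (lift ord0 i)).
  exact: measurable_rV_coord.
by apply/funext => p; rewrite mxE.
Qed.

Section lebesgue_rVS.
Variables (n : nat) (m : {sigma_finite_measure set 'rV[R]_n -> \bar R}).

Definition lebesgue_rVS : set 'rV[R]_n.+1 -> \bar R :=
  pushforward (@lebesgue_measure R \x m)%E (@rV_cons n).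

HB.instance Definition _ := Measure.copy lebesgue_rVS
  (measure_function_pushforward__canonical__measure_function_Measure
     (@lebesgue_measure R \x m)%E (@measurable_rV_cons n)).

Let lebesgue_rVS_sigma_finite : sigma_finite [set: 'rV[R]_n.+1] lebesgue_rVS.
Proof.
have /sigma_finiteP[F [TF ndF Foo]] := sigma_finiteT (@lebesgue_measure R).
have /sigma_finiteP[G [TG ndG Goo]] := sigma_finiteT m.
exists (fun k => @rV_uncons n @^-1` (F k `*` G k)).
  rewrite -preimage_bigcup (_ : \bigcup_i _ = setT) ?preimage_setT//.
  apply/seteqP; split => // -[x y] _.
  have [i _ Fx] : (\bigcup_i F i) x by rewrite -TF.
  have [j _ Gy] : (\bigcup_j G j) y by rewrite -TG.
  exists (maxn i j) => //; split => /=.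
    by move: x Fx; exact/subsetPset/ndF/leq_maxl.
  by move: y Gy; exact/subsetPset/ndG/leq_maxr.
move=> k; have [mF Fk] := Foo k; have [mG Gk] := Goo k; split.
  rewrite -[X in measurable X]setTI; apply: measurable_rV_uncons => //.
  exact: measurableX.
rewrite /lebesgue_rVS /pushforward -comp_preimage.
rewrite (_ : _ \o _ = id) ?preimage_id; last exact/funext/rV_consK.
by rewrite product_measure1E// lte_mul_pinfty// ge0_fin_numE.
Qed.

HB.instance Definition _ :=
  Measure_isSigmaFinite.Build _ _ _ lebesgue_rVS lebesgue_rVS_sigma_finite.

End lebesgue_rVS.

(* Iterated product of the one-dimensional Lebesgue measure, transported along
   R x R^k ~ R^k.+1 (see lebesgue_rV_box for its value on boxes). *)
Fixpoint lebesgue_rV n : {sigma_finite_measure set 'rV[R]_n -> \bar R} :=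
  match n with
  | 0%N => \d_(0 : 'rV[R]_0)
  | k.+1 => lebesgue_rVS (lebesgue_rV k)
  end.

Lemma lebesgue_rV_box n (A : 'I_n -> set R) : (forall i, measurable (A i)) ->
  lebesgue_rV n [set x | forall i, A i (x ord0 i)] =
  (\big[*%E/1]_(i < n) lebesgue_measure (A i))%E.
Proof.
elim: n A => [|n IH] A mA.
  rewrite big_ord0 /= diracE (_ : _ \in _ = true)//.
  by apply/mem_set => -[].
have mB : measurable
    [set x : 'rV[R]_n | forall i, A (lift ord0 i) (x ord0 i)].
  rewrite (_ : mkset _ =
      \bigcap_(i in setT) (rV_coord i @^-1` A (lift ord0 i))).
    apply: fin_bigcap_measurable => // i _.
    by rewrite -[X in measurable X]setTI; exact: measurable_rV_coord.
  by apply/seteqP; split => [x Ax i _|x Ax i]; [exact: Ax|exact: Ax i I].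
rewrite big_ord_recl -IH//= /lebesgue_rVS /pushforward -product_measure1E//; last exact: (mA ord0).
congr (_ _); apply/seteqP; split => -[a x] /=.
  move=> Ax; split => /=.
    by have := Ax ord0; rewrite mxE unlift_none.
  by move=> i; have := Ax (lift ord0 i); rewrite mxE liftK.
move=> [/= Aa Ax] i; rewrite mxE.
by case: (unliftP ord0 i) => [j ->|->] /=.
Qed.

End lebesgue_rV.

Section geometry.
Context (R : realType) (d : nat).
Local Notation pt := 'rV[R]_d.
Implicit Types (A Omega : set pt) (x y n : pt).

Definition dot x y : R := \sum_i x ord0 i * y ord0 i.

(* The library norm of 'rV[R]_d is the sup norm; only its topology is used. *)
Definition enorm x : R := Num.sqrt (dot x x).

Definition diam A : R := sup [set enorm (x - y) | x in A & y in A].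

Definition inscribed_diam A : R :=
  sup [set 2 * r | r in [set r | 0 < r /\
    exists c, [set x | enorm (x - c) <= r] `<=` A]].

Definition bd A : set pt := closure A `\` A°.

Definition conv_hull (I : finType) (X : I -> pt) (s : {set I}) : set pt :=
  [set x | exists c : I -> R, [/\ forall i, 0 <= c i,
    \sum_(i in s) c i = 1 & x = \sum_(i in s) c i *: X i]].

Definition affinely_independent (I : finType) (X : I -> pt) (s : {set I}) :=
  forall c : I -> R, \sum_(i in s) c i = 0 -> \sum_(i in s) c i *: X i = 0 ->
  forall i, i \in s -> c i = 0.

(* Near each boundary point, Omega is the strict epigraph, in some direction n,
   of a Lipschitz function of the coordinates orthogonal to n; such a function
   is encoded as a function on the whole space that is invariant along n. *)
Definition lipschitz_boundary Omega := forall x0, bd Omega x0 ->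
  exists (n : pt) (g : pt -> R) (L r : R),
    [/\ 0 < r, enorm n = 1, forall x t, g (x + t *: n) = g x,
        forall x y, `|g x - g y| <= L * enorm (x - y) &
        forall x, enorm (x - x0) < r -> (Omega x <-> g x < dot x n)].

(* The boundary is a finite union of flat convex polytopes. *)
Definition polyhedral_boundary Omega :=
  exists (N : nat) (X : 'I_N -> pt) (F : {set {set 'I_N}}),
    bd Omega = \bigcup_(s in [set` F]) conv_hull X s /\
    forall s, s \in F -> exists (n : pt) (c : R),
      n != 0 /\ forall i, i \in s -> dot (X i) n = c.

Definition polyhedral_lipschitz_domain Omega :=
  [/\ open Omega, connected Omega, Omega !=set0, bounded_set Omega &
      lipschitz_boundary Omega /\ polyhedral_boundary Omega].

End geometry.

(* Elements of L^2(Omega) are represented by Borel functions on the whole space,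
   identified up to almost everywhere equality on Omega: all the notions below
   are insensitive to null sets and to the values outside Omega. *)
Section spaces.
Context (R : realType) (d : nat) (Omega : set 'rV[R]_d).
Local Notation pt := 'rV[R]_d.
Local Notation mu := (lebesgue_rV R d).
Implicit Types (D : set pt) (f g w : pt -> R) (u v : pt -> pt).

Definition ae_in D (P : pt -> Prop) := {ae mu, forall x, D x -> P x}.

Definition ip D f g : R := \int[mu]_(x in D) (f x * g x).

Definition ipv D u v : R := \int[mu]_(x in D) dot (u x) (v x).

Definition L2 f := measurable_fun Omega f /\ finite_norm mu 2%:E (f \_ Omega).

Definition L2v v := forall i, L2 (fun x => v x ord0 i).

Definition L20 f := L2 f /\ \int[mu]_(x in Omega) f x = 0.

Definition basis_vec (i : 'I_d) : pt := delta_mx ord0 i.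

Definition grad f (x : pt) : pt := \row_i 'D_(basis_vec i) f x.

Fixpoint C_n (n : nat) f : Prop := continuous f /\
  match n with
  | 0%N => True
  | k.+1 => forall i, (forall x, derivable f x (basis_vec i)) /\
                      C_n k (fun x => 'D_(basis_vec i) f x)
  end.

Definition smooth f := forall n, C_n n f.

Definition test_fun f := let S := closure [set x | f x != 0] in
  [/\ smooth f, compact S & S `<=` Omega].

Definition is_grad f (G : pt -> pt) := L2v G /\
  forall phi, test_fun phi -> forall i,
    ip Omega f (fun x => grad phi x ord0 i) =
    - ip Omega (fun x => G x ord0 i) phi.

Definition is_div v w := [/\ L2v v, L2 w &
  forall phi, test_fun phi -> ipv Omega v (grad phi) = - ip Omega w phi].

(* Weak derivatives are unique almost everywhere; these are representatives. *)
Definition wgrad f : pt -> pt := xget (fun=> 0) [set G | is_grad f G].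

Definition wdiv v : pt -> R := xget (fun=> 0) [set w | is_div v w].

(* H^1_0(Omega), as the closure of the test functions in H^1(Omega). *)
Definition H10 f := L2 f /\ exists2 G, is_grad f G &
  forall eps : R, 0 < eps -> exists2 phi, test_fun phi &
    \int[mu]_(x in Omega) ((f x - phi x) ^+ 2 +
      enorm (G x - grad phi x) ^+ 2) < eps.

Definition H10v v := forall i, H10 (fun x => v x ord0 i).

(* The normal trace of v in H(div) as a functional, given by Green's formula,
   on the (dense in H^1) restrictions to Omega of smooth functions. *)
Definition normal_trace v phi : R :=
  ipv Omega v (grad phi) + ip Omega (wdiv v) phi.

Definition H0div v := (exists w, is_div v w) /\
  forall phi, smooth phi -> normal_trace v phi = 0.

End spaces.

(* A simplex is given by the set of (indices of) its vertices. *)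
Record triangulation (R : realType) (d : nat) (Omega : set 'rV[R]_d) :=
  Triangulation {
    nb_vert : nat ;
    vert : 'I_nb_vert -> 'rV[R]_d ;
    elts : {set {set 'I_nb_vert}} ;
    card_elt : forall T, T \in elts -> #|T| = d.+1 ;
    elt_nondegenerate : forall T, T \in elts -> affinely_independent vert T ;
    elts_cover : closure Omega = \bigcup_(T in [set` elts]) conv_hull vert T ;
    elts_conforming : forall T1 T2, T1 \in elts -> T2 \in elts ->
      conv_hull vert T1 `&` conv_hull vert T2 = conv_hull vert (T1 :&: T2)
  }.

Section discretization.
Context (R : realType) (d : nat) (Omega : set 'rV[R]_d).
Variable Th : triangulation Omega.
Local Notation pt := 'rV[R]_d.
Local Notation simplex := {set 'I_(nb_vert Th)}.
Local Notation hull := (conv_hull (@vert _ _ _ Th)).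
Implicit Types (T e : simplex) (u v : pt -> pt) (p q : pt -> R).

Definition shape_regular (sigma : R) := forall T, T \in elts Th ->
  diam (hull T) <= sigma * inscribed_diam (hull T).

Definition face_of e T := (#|e| == d) && (e \subset T).

Definition interior_faces : {set simplex} :=
  [set e : simplex | (#|e| == d) &&
     (#|[set T in elts Th | e \subset T]%SET| == 2)%N]%SET.

Definition V1h v := H10v Omega v /\ forall T, T \in elts Th ->
  exists (A : 'M[R]_d) (b : pt), ae_in (hull T) (fun x => v x = x *m A + b).

Definition RT_on T v (a : pt) (b : R) :=
  ae_in (hull T) (fun x => v x = a + b *: x).

Definition RT0 v := H0div Omega v /\ forall T, T \in elts Th ->
  exists (a : pt) (b : R), RT_on T v a b.

Definition Vh v := exists v1 vR, [/\ V1h v1, RT0 vR & v = v1 \+ vR].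

Definition Wh q := L20 Omega q /\ forall T, T \in elts Th ->
  exists c : R, ae_in (hull T) (fun x => q x = c).

Definition normal_to e (n : pt) := enorm n = 1 /\
  forall i j, i \in e -> j \in e -> dot (vert i - vert j) n = 0.

(* The RT0 basis function of e, up to its normalization: supported on the two
   elements containing e, with zero normal component on all faces but e. *)
Definition RT_basis_fun e v := [/\ RT0 v,
  forall T, T \in elts Th -> ~~ (e \subset T) ->
    ae_in (hull T) (fun x => v x = 0) &
  forall T a b, T \in elts Th -> RT_on T v a b ->
    forall e' n x, face_of e' T -> normal_to e' n -> hull e' x ->
      (dot (a + b *: x) n == 0) = (e' != e)].

Variables (Phi : simplex -> pt -> pt) (alpha : simplex -> R).

Definition RT_coef v : simplex -> R := xget (fun=> 0)
  [set c | ae_in Omega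
             (fun x => v x = \sum_(e in interior_faces) c e *: Phi e x)].

Definition form_a0 u v : R := \sum_(T in elts Th)
  alpha T * (diam (hull T)) ^- 2 * ipv (hull T) u v.

Definition form_aD u v : R := \sum_(T in elts Th)
  \sum_(e in interior_faces | face_of e T)
    alpha T * (diam (hull T)) ^- 2 * RT_coef u e * RT_coef v e *
    ipv (hull T) (Phi e) (Phi e).

Definition form_adiv u v : R := \sum_(T in elts Th)
  \sum_(e in interior_faces | face_of e T)
    alpha T * RT_coef u e * RT_coef v e *
    ip (hull T) (wdiv Omega (Phi e)) (wdiv Omega (Phi e)).

(* Defined up to null sets, the sum V1h + RT0 being direct. *)
Definition Vh_split v : (pt -> pt) * (pt -> pt) := xget (fun=> 0, fun=> 0)
  [set w | [/\ V1h w.1, RT0 w.2 & v = w.1 \+ w.2]].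

Definition form_a u v : R := \sum_(i < d)
  ipv Omega (wgrad Omega (fun x => u x ord0 i))
            (wgrad Omega (fun x => v x ord0 i)).

Definition form_b v q : R := ip Omega (wdiv Omega v) q.

Variable aR : (pt -> pt) -> (pt -> pt) -> R.

Definition form_ah u v : R :=
  form_a (Vh_split u).1 (Vh_split v).1 + aR (Vh_split u).2 (Vh_split v).2.

Definition stokes_solution (nu : R) (f u : pt -> pt) p :=
  [/\ Vh u, Wh p,
      forall v, Vh v -> nu * form_ah u v - form_b v p = ipv Omega f v &
      forall q, Wh q -> form_b u q = 0].

End discretization.

(* Main.v *)
(**
The divergence of [uh] is constant on each element, because [uh] is affine
there, and has zero mean, so that it is an admissible test function [q] in the
second equation, which then says that its square has zero integral.  Only weak
divergences on the whole domain are available.  On an element [T], the constant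
is identified by testing against [phi * chi m], where [chi m] is a smooth
exhaustion of the interior of [T], a product of functions [exp (- 1 / t)] of the
barycentric coordinates: the field being affine on the support, an integration
by parts and dominated convergence show that the weak divergence minus the trace
of the linear part integrates to zero against [phi] on [T].  Interiors of
elements lie in [Omega] because a Lipschitz domain is the interior of its
closure, and they exhaust it up to finitely many hyperplanes.
*)
Require Import Defs.
From HB Require Import structures.
From mathcomp Require Import all_boot all_order all_algebra.
From mathcomp Require Import all_classical all_reals all_analysis.
From mathcomp Require Import measurable_realfun.
From mathcomp Require Import ring lra.

Set Implicit Arguments.
Unset Strict Implicit.
Unset Printing Implicit Defensive.

Import Order.TTheory GRing.Theory Num.Theory.
Import numFieldNormedType.Exports.

Local Open Scope classical_set_scope.
Local Open Scope ring_scope.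

(** * Measurability and null sets for row vectors *)

(** [is_div] determines a divergence only through test functions on all of [Omega], whereas [form_b]
    evaluates one chosen representative, [wdiv]. Uniqueness almost everywhere is bypassed: on each
    element a single constant [c T] is shown to serve every weak divergence of the field. It can
    then be evaluated on whichever is convenient: zero mean is read off the diagonal of the weak
    gradients plus the RT0 divergence, orthogonality off [wdiv]. The admissible function [q] is
    assembled from these constants, not from [wdiv] itself. The identity on an element carries a
    free smooth factor [phi]: the constant [1] gives the means, and a test function gives the
    conclusion. Positivity of the measure [m T] of an element is bypassed as well: the second
    equation makes the sum of the [c T ^+ 2 * m T] vanish, and either [c T = 0] or [m T = 0] kills
    the contribution of [T]. *)

Lemma measurable_dot (R : realType) n (a : 'rV[R]_n) :
  measurable_fun [set: 'rV[R]_n] (fun x => dot x a).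
Proof.
by apply: measurable_sum => i; apply: measurable_funM => //; exact: measurable_rV_coord.
Qed.

Lemma measurable_rV_box (R : realType) n (A : 'I_n -> set R) :
  (forall i, measurable (A i)) ->
  measurable [set x : 'rV[R]_n | forall i, A i (x ord0 i)].
Proof.
move=> mA; rewrite (_ : mkset _ = \bigcap_(i in setT) (@rV_coord R n i @^-1` A i)).
  apply: fin_bigcap_measurable => // i _.
  by rewrite -[X in measurable X]setTI; exact: measurable_rV_coord.
by apply/seteqP; split => [x Ax i _|x Ax i]; [exact: Ax|exact: Ax i I].
Qed.

(* An open set is the union of the rational sup-norm balls that it contains. *)
Lemma open_measurable_rV (R : realType) n (U : set 'rV[R]_n) :
  open U -> measurable U.
Proof.
move=> oU.
pose B (p : 'rV[rat]_n * nat) : set 'rV[R]_n :=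
  [set x | forall i, `](ratr (p.1 ord0 i) - p.2.+1%:R^-1),
    (ratr (p.1 ord0 i) + p.2.+1%:R^-1)[%classic (x ord0 i)].
have -> : U = \bigcup_p (if `[< B p `<=` U >] then B p else set0).
  apply/seteqP; split => [x Ux|x [p _]]; last by case: asboolP => // BU /BU.
  have /nbhs_ballP[e /= e0 eU] : nbhs x U by exact: open_nbhs_nbhs.
  (* With a rational centre within [r] of [x], the box of half-width [r] contains [x] and lies
     within [2 * r < e] of it. *)
  have [k ke] : exists k, k.+1%:R^-1 < e / 2.
    have [k _ /(_ k (leqnn k))] := near_infty_natSinv_lt (PosNum (divr_gt0 e0 (ltr0n _ 2))).
    by exists k.
  set r : R := k.+1%:R^-1 in ke.
  have r0 : 0 < r by rewrite invr_gt0 ltr0n.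
  have /choice[q Hq] : forall i, exists q : rat, `|x ord0 i - ratr q| < r.
    move=> i.
    have [q] : exists q : rat, ratr q \in `](x ord0 i - r), (x ord0 i + r)[.
      by apply: rat_in_itvoo; rewrite ltrBlDr -addrA ltrDl addr_gt0.
    rewrite in_itv/= => /andP[q1 q2]; exists q.
    by rewrite ltr_norml; apply/andP; split; lra.
  exists (\row_i q i, k) => //; case: asboolP => [_ i /=|].
    rewrite in_itv/= mxE -/r; have := Hq i; rewrite ltr_norml => /andP[h1 h2].
    by apply/andP; split; lra.
  case => y /= By; apply: eU; split => // i j; rewrite (ord1 i) /ball/=.
  have := By j; rewrite /= in_itv/= mxE -/r => /andP[h1 h2].
  have := Hq j; rewrite ltr_norml => /andP[h3 h4].
  by rewrite ltr_norml; apply/andP; split; lra.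
apply: countable_bigcupT_measurable; first exact: countableP.
move=> p; case: asboolP => // _.
apply: (@measurable_rV_box _ _ (fun i => `](ratr (p.1 ord0 i) - p.2.+1%:R^-1),
  (ratr (p.1 ord0 i) + p.2.+1%:R^-1)[%classic)).
by move=> i; exact: measurable_itv.
Qed.

Lemma continuous_measurable_rV (R : realType) n (f : 'rV[R]_n -> R) :
  continuous f -> measurable_fun setT f.
Proof.
move=> cf; apply: (measurability _ (measurable_realfun.RGenOpens.measurableE R)) => _ [_ [a [b ->] <-]].
rewrite setTI; apply: open_measurable_rV; move/continuousP: cf; apply.
exact: interval_open.
Qed.

(** Slicing along the first coordinate: either every slice is again a hyperplane, one dimension
    lower, or the normal points along the first axis and all slices but one are empty. *)
Lemma hyperplane_null (R : realType) n (a : 'rV[R]_n) (b : R) : a != 0 ->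
  lebesgue_rV R n [set x | dot x a = b] = 0%E.
Proof.
elim: n a b => [|n IH] a b a0.
  by exfalso; move/eqP: a0; apply; apply/rowP => -[].
have mH m (c : 'rV[R]_m) t : measurable [set x | dot x c = t].
  rewrite (_ : mkset _ = (fun x => dot x c) @^-1` [set t])//.
  by rewrite -[X in measurable X]setTI; exact: measurable_dot.
pose a' : 'rV[R]_n := \row_i a ord0 (lift ord0 i).
have dotE s (x : 'rV[R]_n) : dot (rV_cons (s, x)) a = s * a ord0 ord0 + dot x a'.
  rewrite /dot big_ord_recl mxE unlift_none/=; congr (_ + _).
  by apply: eq_bigr => i _; rewrite !mxE liftK.
rewrite /= /lebesgue_rVS /pushforward /product_measure1 /=.
have [a'0|a'0] := eqVneq a' 0; last first.
  rewrite integral0_eq// => s _ /=.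
  rewrite (_ : xsection _ _ = [set x | dot x a' = b - s * a ord0 ord0]); first exact: IH.
  apply/seteqP; split => x; rewrite /xsection/= inE/= dotE => h; lra.
have a00 : a ord0 ord0 != 0.
  apply: contra a0 => /eqP a00; apply/eqP/rowP => i; rewrite [RHS]mxE.
  case: (unliftP ord0 i) => [j ->|-> //].
  by move/rowP/(_ j): a'0; rewrite !mxE.
set F := (X in integral _ _ X).
have F0 s : s != b / a ord0 ord0 -> F s = 0%E.
  move=> sb; rewrite /F/= (_ : xsection _ _ = set0) ?measure0//.
  apply/seteqP; split => x //; rewrite /xsection/= inE/= dotE a'0.
  rewrite (_ : dot x 0 = 0) ?addr0; last by apply: big1 => i _; rewrite mxE mulr0.
  by move=> h; move/eqP: sb; apply; rewrite -h mulfK.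
rewrite (ae_eq_integral (cst 0%E)) ?integral0//.
- rewrite /F; apply: measurable_fun_xsection.
  rewrite -[X in measurable X]setTI; by apply: measurable_rV_cons => //; exact: mH.
- exists [set b / a ord0 ord0]; split => //; first exact: lebesgue_measure_set1.
  by move=> s /= h; apply/eqP; apply: contra_notT h => sb _; exact: F0.
Qed.

(** * Integrals of partial derivatives *)

Lemma rV_continuous (T : topologicalType) (R : realType) n (f : T -> 'rV[R]_n) :
  (forall i, continuous (fun t => f t ord0 i)) -> continuous f.
Proof.
move=> cf t; apply/cvg_ballP => e e0.
have : \forall t' \near t, forall i, ball (f t ord0 i) e (f t' ord0 i).
  by apply: filter_forall => i; move/cvg_ballP: (cf i t) => /(_ _ e0).
by apply: filterS => t' h; split => // j i; rewrite (ord1 j); exact: h.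
Qed.

(** A chain rule along one line: [c] carries direction [v] to direction [w], so the two difference
    quotients coincide and a directional derivative of [f] suffices. *)
Lemma is_derive_line (R : realType) (V W : normedModType R) (f : W -> R)
    (c : V -> W) (x v : V) (w : W) (df : R) :
  (forall h : R, c (h *: v + x) = h *: w + c x) ->
  is_derive (c x) w f df -> is_derive x v (f \o c) df.
Proof.
move=> cE [dxf <-].
have E : (fun h : R => h^-1 *: (((f \o c) \o shift x) (h *: v) - (f \o c) x)) =
         (fun h : R => h^-1 *: ((f \o shift (c x)) (h *: w) - f (c x))).
  by apply/funext => h /=; rewrite cE.
by apply: DeriveDef; rewrite /derivable /derive E.
Qed.

Definition sup_box (R : realType) n (M : R) : set 'rV[R]_n :=
  [set x | forall i, `|x ord0 i| <= M].

Lemma measurable_sup_box (R : realType) n (M : R) :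
  measurable (@sup_box R n M).
Proof.
apply: (@measurable_rV_box _ _ (fun=> [set y : R | `|y| <= M])) => _.
rewrite (_ : mkset _ = `[- M, M]%classic); first exact: measurable_itv.
by apply/seteqP; split => y /=; rewrite in_itv/= -ler_norml.
Qed.

Lemma sup_box_finite (R : realType) n (M : R) :
  (lebesgue_rV R n (@sup_box R n M) < +oo)%E.
Proof.
have E : [set y : R | `|y| <= M] = `[- M, M]%classic.
  by apply/seteqP; split => y /=; rewrite in_itv/= -ler_norml.
rewrite /sup_box (@lebesgue_rV_box _ _ (fun=> [set y : R | `|y| <= M])); last first.
  by move=> _; rewrite E; exact: measurable_itv.
rewrite ltey_eq; apply/orP; left.
apply: (big_ind (fun y : \bar R => y \is a fin_num)) => // [x y|i _]; first exact: fin_numM.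
by rewrite E lebesgue_measure_itv /=; case: ifP.
Qed.

Lemma box_integrable (R : realType) n (g : 'rV[R]_n -> R) (M C : R) :
  continuous g -> (forall x, `|g x| <= C) ->
  (forall x : 'rV[R]_n, (exists i, M < `|x ord0 i|) -> g x = 0) ->
  (lebesgue_rV R n).-integrable setT (EFin \o g).
Proof.
move=> cg gC g0.
pose B := @sup_box R n M.
have mB : measurable B by exact: measurable_sup_box.
have gB : g = g \_ B.
  apply/funext => x; rewrite patchE; case: ifPn => //; rewrite notin_setE /B/= => nB.
  apply: g0; apply: contrapT => /forallNP h; apply: nB => i.
  by rewrite leNgt; apply/negP/h.
rewrite gB -restrict_EFin; apply/(integrable_mkcond _ mB).
apply: measurable_bounded_integrable => //.
- exact: sup_box_finite.
- exact: measurable_funTS (continuous_measurable_rV cg).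
- exists C; split; first exact: num_real.
  by move=> y Cy x _ /=; rewrite (le_trans (gC x))// ltW.
Qed.

Lemma integral_derive_compact_support_R (R : realType) (F f : R -> R) (M : R) :
  continuous f -> (forall s : R, is_derive s 1 F (f s)) ->
  (forall s, M < `|s| -> F s = 0) -> (forall s, M < `|s| -> f s = 0) ->
  (\int[lebesgue_measure]_s (f s)%:E = 0)%E.
Proof.
move=> cf dF F0 f0.
(* [N] is positive and exceeds [M] strictly, so that [F] vanishes at both ends of a nondegenerate
   interval. *)
pose N : R := `|M| + 1.
have MN : M < N by rewrite /N; have := ler_norm M; lra.
have N0 : 0 < N by rewrite /N; have := normr_ge0 M; lra.
have cF : continuous F.
  by move=> x; apply: differentiable_continuous; apply/derivable1_diffP; case: (dF x).
transitivity (\int[lebesgue_measure]_(s in `[(- N)%R, N]) (f s)%:E)%E.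
  rewrite [RHS]integral_mkcond; apply: eq_integral => s _.
  rewrite patchE; case: ifPn => //; rewrite notin_setE/= in_itv/= => /negP sN.
  by rewrite f0//; apply: (lt_trans MN); move: sN; rewrite -ler_norml -ltNge.
rewrite (@continuous_FTC2 _ f F).
- by rewrite F0 ?normrN ?ger0_norm ?(ltW N0)// F0 ?normrN ?ger0_norm ?(ltW N0)// subee.
- lra.
- exact: continuous_subspaceT.
- split.
  + by move=> x _; case: (dF x).
  + by apply: cvg_at_right_filter; exact: cF.
  + by apply: cvg_at_left_filter; exact: cF.
- by move=> x _; rewrite derive1E; case: (dF x).
Qed.

Lemma rV_cons_ord0 (R : realType) n s (x : 'rV[R]_n) : rV_cons (s, x) ord0 ord0 = s.
Proof. by rewrite mxE unlift_none. Qed.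

Lemma rV_cons_lift (R : realType) n s (x : 'rV[R]_n) i :
  rV_cons (s, x) ord0 (lift ord0 i) = x ord0 i.
Proof. by rewrite mxE liftK. Qed.

Lemma basis_vecE (R : realType) n (i j : 'I_n) : basis_vec R i ord0 j = (j == i)%:R.
Proof. by rewrite mxE eqxx. Qed.

(** The measure is an iterated product, so Fubini peels off the first coordinate: if [i] is that
    coordinate, the inner integral is the one-dimensional case; otherwise each slice is an instance
    of the same statement in dimension [n]. *)
Lemma integral_partial_eq0 (R : realType) n (i : 'I_n) (psi g : 'rV[R]_n -> R) (M C : R) :
  continuous g -> (forall x, is_derive x (basis_vec R i) psi (g x)) ->
  (forall x, `|g x| <= C) ->
  (forall x : 'rV[R]_n, (exists j, M < `|x ord0 j|) -> psi x = 0) ->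
  (forall x : 'rV[R]_n, (exists j, M < `|x ord0 j|) -> g x = 0) ->
  (\int[lebesgue_rV R n]_x (g x)%:E = 0)%E.
Proof.
elim: n i psi g => [[]//|n IH] i psi g cg dpsi gC psi0 g0.
have mg : measurable_fun setT (EFin \o g).
  by apply/measurable_EFinP; exact: continuous_measurable_rV.
have ig := box_integrable cg gC g0.
have mc := @measurable_rV_cons R n.
have igc : (lebesgue_measure \x lebesgue_rV R n)%E.-integrable setT
    ((EFin \o g) \o @rV_cons R n).
  apply/integrableP; split; first exact: measurableT_comp.
  case/integrableP : ig => _; rewrite /= /lebesgue_rVS ge0_integral_pushforward//.
  exact: (measurableT_comp (@abse_measurable R setT) mg).
rewrite /= /lebesgue_rVS integral_pushforward// preimage_setT.
have cc1 x : continuous (fun s => rV_cons (s, x) : 'rV[R]_n.+1).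
  apply: rV_continuous => j; case: (unliftP ord0 j) => [k ->|->].
    under eq_fun do rewrite rV_cons_lift; exact: cst_continuous.
  by under eq_fun do rewrite rV_cons_ord0; move=> s; exact: cvg_id.
have cc2 s : continuous (fun x => rV_cons (s, x) : 'rV[R]_n.+1).
  apply: rV_continuous => j; case: (unliftP ord0 j) => [k ->|->].
    under eq_fun do rewrite rV_cons_lift; exact: coord_continuous.
  by under eq_fun do rewrite rV_cons_ord0; exact: cst_continuous.
case: (unliftP ord0 i) => [j|] ij.
- rewrite -integral12_prod_meas1//; apply: integral0_eq => s _ /=.
  rewrite /fubini_F/=; apply: (IH j (fun x => psi (rV_cons (s, x)))).
  + move=> x; apply: continuous_comp; [exact: cc2|exact: cg].
  + move=> x; apply: (is_derive_line (f := psi) (c := fun x => rV_cons (s, x)) (w := basis_vec R i)).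
      move=> h; apply/rowP => k; rewrite [RHS]mxE [X in _ = X + _]mxE basis_vecE ij.
      case: (unliftP ord0 k) => [l ->|->].
        by rewrite !rV_cons_lift mxE [X in X + _]mxE basis_vecE (inj_eq lift_inj).
      by rewrite !rV_cons_ord0 mulr0 add0r.
  + by move=> x; exact: gC.
  + move=> x [k xk]; apply: psi0; exists (lift ord0 k); by rewrite rV_cons_lift.
  + move=> x [k xk]; apply: g0; exists (lift ord0 k); by rewrite rV_cons_lift.
- rewrite -integral21_prod_meas1//; apply: integral0_eq => x _ /=.
  rewrite /fubini_G/=; apply: (@integral_derive_compact_support_R _ (fun s => psi (rV_cons (s, x))) _ M).
  + move=> s; apply: continuous_comp; [exact: cc1|exact: cg].
  + move=> s; apply: (is_derive_line (f := psi) (c := fun s => rV_cons (s, x)) (w := basis_vec R i)).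
      move=> h; apply/rowP => k; rewrite [RHS]mxE [X in _ = X + _]mxE basis_vecE ij.
      case: (unliftP ord0 k) => [l ->|->].
        by rewrite !rV_cons_lift mulr0 add0r.
      by rewrite !rV_cons_ord0 eqxx.
  + by move=> s sM; apply: psi0; exists ord0; rewrite rV_cons_ord0.
  + by move=> s sM; apply: g0; exists ord0; rewrite rV_cons_ord0.
Qed.

(** * Smooth functions *)

Lemma C_n_cst (R : realType) d n (c : R) : C_n n (cst c : 'rV[R]_d -> R).
Proof.
elim: n c => [|n IH] c; split=> //; try exact: cst_continuous.
move=> i; split => [x|]; first exact: derivable_cst.
by under eq_fun do rewrite derive_cst; exact: IH.
Qed.

Lemma C_nS (R : realType) d n (f : 'rV[R]_d -> R) : C_n n.+1 f -> C_n n f.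
Proof.
elim: n f => [|n IH] f /= [cf hf]; split => // i.
by have [df Cf] := hf i; split => //; exact: IH.
Qed.

Lemma C_nD (R : realType) d n (f g : 'rV[R]_d -> R) :
  C_n n f -> C_n n g -> C_n n (fun x => f x + g x).
Proof.
elim: n f g => [|n IH] f g [cf hf] [cg hg]; split => //.
- by move=> x; exact: (cvgD (cf x) (cg x)).
- by move=> x; exact: (cvgD (cf x) (cg x)).
move=> i; have [df Cf] := hf i; have [dg Cg] := hg i.
split => [x|]; first by apply: derivableD; [exact: df|exact: dg].
by under eq_fun do rewrite deriveD//; exact: IH.
Qed.

Lemma C_nM (R : realType) d n (f g : 'rV[R]_d -> R) :
  C_n n f -> C_n n g -> C_n n (fun x => f x * g x).
Proof.
elim: n f g => [|n IH] f g [cf hf] [cg hg]; split => //.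
- by move=> x; exact: (cvgM (cf x) (cg x)).
- by move=> x; exact: (cvgM (cf x) (cg x)).
move=> i; have [df Cf] := hf i; have [dg Cg] := hg i.
split => [x|]; first by apply: derivableM; [exact: df|exact: dg].
under eq_fun do rewrite deriveM//.
apply: C_nD; apply: IH => //; exact: C_nS.
Qed.

Lemma smooth_cst (R : realType) d (c : R) : smooth (cst c : 'rV[R]_d -> R).
Proof. by move=> n; exact: C_n_cst. Qed.

Lemma smoothM (R : realType) d (f g : 'rV[R]_d -> R) :
  smooth f -> smooth g -> smooth (fun x => f x * g x).
Proof. by move=> sf sg n; exact: C_nM. Qed.

Lemma smooth_prod (R : realType) d (I : Type) (s : seq I) (P : pred I)
    (f : I -> 'rV[R]_d -> R) : (forall i, P i -> smooth (f i)) ->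
  smooth (fun x => \prod_(i <- s | P i) f i x).
Proof.
move=> sf; elim: s => [|i s IH].
  by under eq_fun do rewrite big_nil; exact: smooth_cst.
under eq_fun do rewrite big_cons.
have [Pi|_] := boolP (P i); last exact: IH.
by apply: smoothM; [exact: sf|exact: IH].
Qed.

Lemma smooth_continuous (R : realType) d (f : 'rV[R]_d -> R) : smooth f -> continuous f.
Proof. by move=> /(_ 0%N) []. Qed.

Lemma smooth_is_derive (R : realType) d (f : 'rV[R]_d -> R) i x :
  smooth f -> is_derive x (basis_vec R i) f (grad f x ord0 i).
Proof. by move=> /(_ 1%N) [_ hf]; rewrite mxE; apply: DeriveDef => //; exact: (hf i).1. Qed.

Lemma smooth_grad (R : realType) d (f : 'rV[R]_d -> R) i :
  smooth f -> smooth (fun x => grad f x ord0 i).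
Proof.
move=> sf n; under eq_fun do rewrite mxE.
by have [_ /(_ i) []] := sf n.+1.
Qed.

Lemma dotDl (R : realType) d (x y a : 'rV[R]_d) : dot (x + y) a = dot x a + dot y a.
Proof. by rewrite /dot -big_split/=; apply: eq_bigr => i _; rewrite mxE mulrDl. Qed.

Lemma dotZl (R : realType) d (k : R) (x a : 'rV[R]_d) : dot (k *: x) a = k * dot x a.
Proof. by rewrite /dot big_distrr/=; apply: eq_bigr => i _; rewrite mxE mulrA. Qed.

Lemma dot_basis_vec (R : realType) d (a : 'rV[R]_d) i : dot (basis_vec R i) a = a ord0 i.
Proof.
rewrite /dot (bigD1 i)//= mxE !eqxx mul1r big1 ?addr0// => j ji.
by rewrite mxE (negbTE ji) mul0r.
Qed.

Lemma dot_continuous (R : realType) d (a : 'rV[R]_d) : continuous (fun x => dot x a).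
Proof.
apply: continuous_big => [|i _ x]; first exact: add_continuous.
exact: (cvgM (@coord_continuous _ _ _ ord0 i x) (cvg_cst _)).
Qed.

Lemma is_derive1_dir (R : realType) (H : R -> R) (y w dH : R) :
  is_derive y 1 H dH -> is_derive y w H (dH * w).
Proof.
move=> [dH1 <-]; have dif : differentiable H y by exact/derivable1_diffP.
apply: DeriveDef; first exact: diff_derivable.
by rewrite !deriveE// -{1}[w]mulr1 [RHS]mulrC -[w * 1]/(w *: (1 : R)) linearZ.
Qed.

(** [H k] plays the k-th derivative of [H 0]. Having the whole sequence at hand closes the
    induction: a partial derivative replaces [H k] by [H k.+1], up to a constant factor. *)
Lemma smooth_comp_affine (R : realType) d (H : nat -> R -> R) (a : 'rV[R]_d) (b : R) :
  (forall k (s : R), is_derive s 1 (H k) (H k.+1 s)) ->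
  smooth (fun x => H 0%N (dot x a + b)).
Proof.
move=> dH; have cH k : continuous (fun x : 'rV[R]_d => H k (dot x a + b)).
  move=> x; apply: (@continuous_comp _ _ _ (fun x => dot x a + b) (H k)).
    exact: (cvgD (@dot_continuous _ _ a x) (cvg_cst _)).
  by apply: differentiable_continuous; apply/derivable1_diffP; case: (dH k (dot x a + b)).
suff : forall n k, C_n n (fun x : 'rV[R]_d => H k (dot x a + b)) by move=> h n; exact: h.
elim => [|n IH] k.
  by split.
split => // i.
have D (x : 'rV[R]_d) :
    is_derive x (basis_vec R i) (fun x => H k (dot x a + b)) (H k.+1 (dot x a + b) * a ord0 i).
  apply: (is_derive_line (f := H k) (c := fun x => dot x a + b) (w := a ord0 i)).
    by move=> h; rewrite dotDl dotZl dot_basis_vec addrA.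
  exact: is_derive1_dir.
split => [x|]; first by case: (D x).
rewrite (_ : (fun x => _) = (fun x : 'rV[R]_d => H k.+1 (dot x a + b) * a ord0 i)).
  apply: C_nM; [exact: IH|exact: C_n_cst].
by apply/funext => x; case: (D x).
Qed.

(** * A flat smooth cutoff on the real line *)

Section exp_cutoff.
Context (R : realType).
Implicit Types (P : {poly R}) (t : R).

(** The classical flat function is the case [P = 1]; the polynomial in [t^-1] makes the family
    stable under differentiation, so that smoothness follows by iteration. *)
Definition exp_cutoff P t : R :=
  if 0 < t then P.[t^-1] * expR (- t^-1) else 0.

Lemma poly_le_expR P : exists C : R, forall u, 0 <= u -> `|P.[u]| <= C * expR u.
Proof.
(* Each monomial obeys [u^i <= i! * expR u], by the exponential series. *)
exists (\sum_(i < size P) `|P`_i| * i`!%:R) => u u0.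
rewrite horner_coef mulr_suml (le_trans (ler_norm_sum _ _ _))// ler_sum// => i _.
rewrite normrM -mulrA ler_wpM2l// ger0_norm ?exprn_ge0//.
case: (nat_of_ord i) => [|n]; first by rewrite mul1r expr0 -expR0 ler_expR.
rewrite mulrC -ler_pdivrMr ?ltr0n ?fact_gt0//.
by apply: le_trans (expR_ge1Dxn n u0); rewrite lerDr.
Qed.

Lemma is_derive_exp_cutoff P t :
  is_derive t 1 (exp_cutoff P) (exp_cutoff ('X^2 * (P - P^`())) t).
Proof.
have [t0|t0|->] := ltgtP t 0.
- rewrite {2}/exp_cutoff ltNge (ltW t0)/=.
  apply: (@near_eq_is_derive _ _ _ (cst 0)).
  by near=> s; rewrite /exp_cutoff ltNge ltW//=; near: s; exact: lt_nbhsl.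
- rewrite {2}/exp_cutoff t0.
  apply: (@near_eq_is_derive R R R (fun s : R => P.[s^-1] * expR (- s^-1))).
    by near=> s; rewrite /exp_cutoff (_ : 0 < s)//; near: s; exact: lt_nbhsr.
  have tn0 : t != 0 by rewrite gt_eqF.
  have dV : is_derive t 1 (fun s : R => s^-1) (- (t ^- 2)).
    have := @is_deriveV _ id t 1 1 tn0 (is_derive_id _ _).
    by rewrite scaler1.
  have dP : is_derive t 1 (fun s : R => P.[s^-1]) (- (t ^- 2) * P^`().[t^-1]).
    by have := is_derive1_comp (is_derive_poly P t^-1) dV; rewrite mulrC.
  have dE : is_derive t 1 (fun s : R => expR (- s^-1)) (t ^- 2 * expR (- t^-1)).
    have dN : is_derive t 1 (fun s : R => - s^-1) (t ^- 2).
      by apply: (is_derive_eq (is_deriveN dV)); rewrite opprK.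
    have := @is_derive1_comp _ expR (fun s : R => - s^-1) t _ _ (is_derive_expR (- t^-1)) dN.
    by rewrite mulrC.
  apply: (is_derive_eq (is_deriveM dP dE)).
  rewrite !hornerE /GRing.scale/= exprVn; ring.
- rewrite {2}/exp_cutoff ltxx.
  (* For [h > 0] the difference quotient at [0] is [h] times the value at [h^-1] of ['X^2 * P],
     divided by [expR h^-1]. The factor ['X^2] pays for the division by [h] and leaves one spare
     [h], which tends to [0]. *)
  have [C HC] := poly_le_expR ('X^2 * P).
  suff L : (fun h : R => h^-1 *: ((exp_cutoff P \o shift 0) (h *: 1) - exp_cutoff P 0))
      @ 0^' --> (0 : R).
    by apply: DeriveDef; [apply/cvg_ex; exists 0|exact: cvg_lim L].
  apply: norm_cvg0; apply: (@squeeze_cvgr _ _ _ _ (cst 0) (fun h => `|C| * `|h|)).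
  + near=> h; rewrite normr_ge0/= addr0 {2}/exp_cutoff ltxx subr0 /GRing.scale/= mulr1.
    rewrite /exp_cutoff; case: ifPn => h0; last first.
      by rewrite mulr0 normr0 mulr_ge0.
    have hn0 : h != 0 by rewrite gt_eqF.
    have : 0 <= h^-1 by rewrite invr_ge0 ltW.
    move=> /HC; rewrite hornerM hornerXn expRN => HCh.
    have E0 := expR_gt0 h^-1.
    rewrite (_ : _ * (_ * _) = h^-1 ^+ 2 * P.[h^-1] / expR h^-1 * h); last first.
      rewrite -[X in _ = _ * X]invrK; field.
      by rewrite hn0 gt_eqF.
    rewrite normrM ler_wpM2r// normrM normfV (gtr0_norm E0) ler_pdivrMr//.
    by rewrite (le_trans HCh)// ler_wpM2r ?expR_ge0// ler_norm.
  + exact: cvg_cst.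
  + rewrite -[X in _ --> X](mulr0 `|C|); apply: cvgM; first exact: cvg_cst.
    rewrite -[X in _ --> X](normr0 R); apply: cvg_norm; exact: cvg_within.
Unshelve. all: by end_near.
Qed.

End exp_cutoff.

(** * Simplices and Lipschitz domains *)

Lemma enorm_continuous (R : realType) d : continuous (@enorm R d).
Proof.
move=> x; apply: (@continuous_comp _ _ _ (fun x => dot x x) Num.sqrt); last exact: sqrt_continuous.
move: x; apply: continuous_big => [|i _ x]; first exact: add_continuous.
exact: (cvgM (@coord_continuous _ _ _ ord0 i x) (@coord_continuous _ _ _ ord0 i x)).
Qed.

Lemma enorm_ge0 (R : realType) d (x : 'rV[R]_d) : 0 <= enorm x.
Proof. exact: sqrtr_ge0. Qed.

Lemma enormZ (R : realType) d (k : R) (x : 'rV[R]_d) : enorm (k *: x) = `|k| * enorm x.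
Proof.
rewrite /enorm dotZl (_ : dot x (k *: x) = k * dot x x).
  by rewrite mulrA -expr2 sqrtrM ?sqr_ge0// sqrtr_sqr.
by rewrite /dot big_distrr/=; apply: eq_bigr => i _; rewrite mxE mulrCA.
Qed.

Lemma enorm0 (R : realType) d : enorm (0 : 'rV[R]_d) = 0.
Proof. by rewrite -(scale0r 0) enormZ normr0 mul0r. Qed.

Lemma subr_cst_continuous (R : realType) d (y : 'rV[R]_d) :
  continuous (fun z : 'rV[R]_d => z - y).
Proof.
apply: rV_continuous => i x; under eq_fun do rewrite mxE.
exact: (cvgD (@coord_continuous _ _ _ ord0 i x) (cvg_cst _)).
Qed.

(* Points just below the graph of a boundary point are exterior points. *)
Lemma lipschitz_interior_closure (R : realType) d (Omega : set 'rV[R]_d) :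
  open Omega -> lipschitz_boundary Omega -> (closure Omega)° `<=` Omega.
Proof.
move=> oO lO x0 ix0; apply: contrapT => nO.
have bx0 : bd Omega x0.
  by split; [exact: interior_subset ix0|move=> /interior_subset].
have [n [g [L [r [r0 n1 gn gL Or]]]]] := lO x0 bx0.
have gx0 : dot x0 n <= g x0.
  rewrite leNgt; apply/negP => gx; apply: nO; apply/(Or x0) => //.
  by rewrite subrr enorm0.
have cl : continuous (fun t : R => x0 - t *: n).
  by move=> t; apply: cvgB; [exact: cvg_cst|apply: cvgZr_tmp; exact: cvg_id].
have c0 : x0 - 0 *: n = x0 by rewrite scale0r subr0.
have : \forall t \near (0 : R), (closure Omega) (x0 - t *: n).
  by apply: (cl 0); rewrite c0.
move=> /nbhs_ballP[e /= e0 he].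
pose t : R := Num.min (e / 2) (r / 2).
have t0 : 0 < t by rewrite lt_min !divr_gt0.
have te : t < e by rewrite gt_min; apply/orP; left; lra.
have tr : t < r by rewrite gt_min; apply/orP; right; lra.
have : closure Omega (x0 - t *: n).
  by apply: he; rewrite /ball/= sub0r normrN gtr0_norm.
set y : 'rV[R]_d := x0 - t *: n => cy.
have gy : g y = g x0 by rewrite /y -scaleNr gn.
have dn : dot n n = 1.
  by move: n1 => /(congr1 (fun u => u ^+ 2)); rewrite sqr_sqrtr ?expr1n// sumr_ge0// => i _;
    rewrite -expr2 sqr_ge0.
have dy : dot y n = dot x0 n - t by rewrite /y -scaleNr dotDl dotZl dn; ring.
have ed : continuous (fun z : 'rV[R]_d => enorm (z - y)).
  move=> z; apply: (@continuous_comp _ _ _ (fun z : 'rV[R]_d => z - y) (@enorm R d));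
    last exact: enorm_continuous.
  exact: subr_cst_continuous.
have ed0 : continuous (fun z : 'rV[R]_d => enorm (z - x0)).
  move=> z; apply: (@continuous_comp _ _ _ (fun z : 'rV[R]_d => z - x0) (@enorm R d));
    last exact: enorm_continuous.
  exact: subr_cst_continuous.
(* The graph passes at least [t] above [y], and close to [y] the Lipschitz variation of [g] cannot
   use up this gap. Hence a whole neighbourhood of [y] lies below the graph, although [y] is in the
   closure of [Omega]. *)
have N1 : \forall z \near y, `|L| * enorm ((z : 'rV[R]_d) - y) + dot z n < dot y n + t.
  have C1 : (fun z : 'rV[R]_d => `|L| * enorm (z - y) + dot z n) @ y --> `|L| * enorm (y - y) + dot y n.
    exact: (cvgD (cvgM (cvg_cst _) (ed y)) (@dot_continuous _ _ n y)).
  by apply: (cvgr_lt _ C1); rewrite subrr enorm0 mulr0 add0r ltrDl.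
have N2 : \forall z \near y, enorm ((z : 'rV[R]_d) - x0) < r.
  have C2 : (fun z : 'rV[R]_d => enorm (z - x0)) @ y --> enorm (y - x0) by exact: ed0.
  apply: (cvgr_lt _ C2).
  by rewrite /y addrC addKr -scaleNr enormZ n1 mulr1 normrN gtr0_norm.
have [z [Oz [z1 z2]]] := cy _ (filterI N1 N2).
have gz := (Or z z2).1 Oz.
have : g y - g z <= `|L| * enorm (z - y).
  rewrite (le_trans (ler_norm _))// distrC (le_trans (gL _ _))//.
  by rewrite ler_wpM2r ?enorm_ge0// ler_norm.
rewrite gy; move: z1 gz gx0; rewrite dy; lra.
Qed.

(** * Barycentric coordinates and open simplices *)

Lemma barycentric_coordinates (R : realType) (d : nat) (I : finType)
    (X : I -> 'rV[R]_d) (s : {set I}) :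
  #|s| = d.+1 -> affinely_independent X s ->
  exists (a : I -> 'rV[R]_d) (b : I -> R), forall x,
    \sum_(i in s) (dot x (a i) + b i) = 1 /\
    \sum_(i in s) (dot x (a i) + b i) *: X i = x.
Proof.
move=> cs ind.
have [i0 i0s] : exists i0, i0 \in s by apply/card_gt0P; rewrite cs.
(* Multiplying weights by [M] returns their total and the weighted sum of the vertices. Affine
   independence makes [M] row free, hence row full since [#|s| = d.+1]; applying its inverse to
   [(1, x)] gives coordinates that are affine in [x]. *)
pose M : 'M[R]_(#|s|, 1 + d) := \matrix_(k < #|s|) row_mx (const_mx 1) (X (enum_val k)).
have mulM (v : 'rV[R]_#|s|) :
    v *m M = row_mx (const_mx (\sum_k v ord0 k)) (\sum_k v ord0 k *: X (enum_val k)).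
  rewrite mulmx_sum_row.
  under eq_bigr do rewrite rowK scale_row_mx.
  apply/rowP => j; rewrite summxE mxE; case: splitP => k jk.
    rewrite mxE; apply: eq_bigr => l _.
    rewrite !mxE; case: splitP => k' jk'; first by rewrite !mxE mulr1.
    by exfalso; move: (ltn_ord k); rewrite -jk jk'.
  rewrite summxE; apply: eq_bigr => l _.
  rewrite !mxE; case: splitP => k' jk'.
    by exfalso; move: (ltn_ord k'); rewrite -jk' jk.
  by rewrite !mxE; congr (_ * X _ _ _); apply: val_inj => /=; apply/eqP; rewrite -(eqn_add2l 1) -jk jk'.
have rfM : row_free M.
  apply: inj_row_free => v; rewrite mulM => /eqP; rewrite row_mx_eq0 => /andP[/eqP/rowP/(_ ord0)].
  rewrite !mxE => v1 /eqP v2.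
  pose c i := v ord0 (enum_rank_in i0s i).
  have c0 : forall i, i \in s -> c i = 0.
    apply: ind; rewrite big_enum_val /c.
      by under eq_bigr do rewrite enum_valK_in.
    by under eq_bigr do rewrite enum_valK_in.
  apply/rowP => k; rewrite mxE -(c0 (enum_val k)) ?enum_valP//.
  by rewrite /c enum_valK_in.
have fM : row_full M by rewrite /row_full (eqP rfM) cs.
pose B := pinvmx M.
pose L (x : 'rV[R]_d) := row_mx (const_mx 1) x *m B.
have LE (x : 'rV[R]_d) k : L x ord0 k = dot x (\row_j B (rshift 1 j) k) + B (lshift d ord0) k.
  rewrite /L mxE big_split_ord/= big_ord1 row_mxEl mxE mul1r addrC; congr (_ + _).
  by apply: eq_bigr => j _; rewrite row_mxEr mxE.
exists (fun i => \row_j B (rshift 1 j) (enum_rank_in i0s i)),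
  (fun i => B (lshift d ord0) (enum_rank_in i0s i)) => x.
have : L x *m M = row_mx (const_mx 1) x by rewrite /L mulmxKpV// submx_full.
rewrite mulM => /eq_row_mx[/rowP/(_ ord0) L1 L2]; move: L1; rewrite !mxE => L1.
split.
  rewrite -[RHS]L1 big_enum_val; apply: eq_bigr => k _.
  by rewrite LE enum_valK_in.
rewrite -[RHS]L2 big_enum_val; apply: eq_bigr => k _.
by rewrite LE enum_valK_in.
Qed.

(** Positive weights are used instead of the topological interior, so that uniqueness of the weights
    can be played against conformity of the triangulation. *)
Definition open_simplex (R : realType) (d : nat) (I : finType) (X : I -> 'rV[R]_d)
    (s : {set I}) : set 'rV[R]_d :=
  [set x | exists c : I -> R, [/\ forall i, i \in s -> 0 < c i,
    \sum_(i in s) c i = 1 & x = \sum_(i in s) c i *: X i]].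

Section simplex.
Context (R : realType) (d : nat) (I : finType).
Variables (X : I -> 'rV[R]_d) (s : {set I}).
Hypotheses (d_gt0 : (0 < d)%N) (card_s : #|s| = d.+1).
Hypothesis ind_s : affinely_independent X s.

Lemma affinely_independent_inj (c c' : I -> R) :
  \sum_(i in s) c i = \sum_(i in s) c' i ->
  \sum_(i in s) c i *: X i = \sum_(i in s) c' i *: X i ->
  forall i, i \in s -> c i = c' i.
Proof.
move=> cc cX i si; apply/eqP; rewrite -subr_eq0; apply/eqP.
apply: (ind_s (c := fun i => c i - c' i)) => //.
  by rewrite sumrB cc subrr.
under eq_bigr do rewrite scalerBl.
by rewrite sumrB cX subrr.
Qed.

Lemma simplex_facets : exists (a : I -> 'rV[R]_d) (b : I -> R),
  [/\ open_simplex X s = [set x | forall i, i \in s -> 0 < dot x (a i) + b i],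
      conv_hull X s = [set x | forall i, i \in s -> 0 <= dot x (a i) + b i] &
      forall i, i \in s -> a i != 0].
Proof.
have [a [b ab]] := barycentric_coordinates card_s ind_s.
exists a, b; split.
- apply/seteqP; split => [x [c [c0 c1 cx]] i si|x x0 /=].
    rewrite -(@affinely_independent_inj c (fun i => dot x (a i) + b i))//; first exact: c0.
      by rewrite c1 (ab x).1.
    by rewrite -cx (ab x).2.
  by exists (fun i => dot x (a i) + b i); split => //; [exact: (ab x).1|rewrite (ab x).2].
- apply/seteqP; split => [x [c [c0 c1 cx]] i si|x x0 /=].
    rewrite -(@affinely_independent_inj c (fun i => dot x (a i) + b i))//.
      by rewrite c1 (ab x).1.
    by rewrite -cx (ab x).2.
  (* [conv_hull] wants nonnegative weights at every index, hence the value [0] outside [s]. *)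
  exists (fun i => if i \in s then dot x (a i) + b i else 0); split.
  + by move=> i; case: ifPn => // si; exact: x0.
  + by rewrite -[RHS](ab x).1; apply: eq_bigr => i ->.
  + by rewrite -[LHS](ab x).2; apply: eq_bigr => i ->.
(* The i-th coordinate is [1] at [X i] and [0] at another vertex, which exists because [d] is
   positive; so it is not constant. *)
- move=> i si; apply/negP => /eqP ai0.
  have [j sj ji] : exists2 j, j \in s & j != i.
    have : (0 < #|s :\ i|)%N by move: card_s; rewrite (cardsD1 i) si add1n => -[->].
    by move=> /card_gt0P[j]; rewrite !inE => /andP[ji sj]; exists j.
  have L k : k \in s -> dot (X k) (a i) + b i = (i == k)%:R.
    move=> sk.
    apply: (@affinely_independent_inj (fun i => dot (X k) (a i) + b i) (fun i => (i == k)%:R)) => //.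
      rewrite (ab (X k)).1 (bigD1 k)//= eqxx big1 ?addr0// => l /andP[_ /negbTE ->].
      by [].
    rewrite (ab (X k)).2 (bigD1 k)//= eqxx scale1r big1 ?addr0// => l /andP[_ /negbTE ->].
    by rewrite scale0r.
  have d0 k : dot (X k) (a i) = 0 by rewrite ai0; apply: big1 => l _; rewrite mxE mulr0.
  have := L i si; have := L j sj; rewrite !d0 eqxx eq_sym (negbTE ji) => ->.
  by move/eqP; rewrite eq_sym oner_eq0.
Qed.

Let affine_continuous (a : 'rV[R]_d) (b : R) : continuous (fun x => dot x a + b).
Proof. by move=> x; exact: (cvgD (@dot_continuous _ _ a x) (cvg_cst _)). Qed.

Lemma open_open_simplex : open (open_simplex X s).
Proof.
have [a [b [-> _ _]]] := simplex_facets.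
suff H (x : 'rV[R]_d) : (forall i, i \in s -> 0 < dot x (a i) + b i) ->
    \forall y \near x, forall i, i \in s -> 0 < dot y (a i) + b i.
  by rewrite openE => x x0; exact: H.
move=> x0; apply: (@filter_forall _ _ (fun i y => i \in s -> 0 < dot y (a i) + b i) (nbhs x)) => i.
have [si|_] := boolP (i \in s); last exact: nearW.
have C : (fun x => dot x (a i) + b i) @ x --> dot x (a i) + b i by exact: affine_continuous.
by apply: (@filterS _ (nbhs x)) (cvgr_gt _ C _ (x0 i si)).
Qed.

Lemma closed_simplex (e : R) (a : I -> 'rV[R]_d) (b : I -> R) :
  closed [set x | forall i, i \in s -> e <= dot x (a i) + b i].
Proof.
rewrite (_ : mkset _ = \bigcap_(i in [set` s]) [set x | e <= dot x (a i) + b i]).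
  apply: closed_bigI => i _.
  apply: (@preimage_closed _ _ (fun x => dot x (a i) + b i) [set y | e <= y]); last exact: closed_ge.
  by move=> x _; exact: affine_continuous.
by apply/seteqP; split.
Qed.

Lemma open_simplex_sub_hull : open_simplex X s `<=` conv_hull X s.
Proof.
have [a [b [-> -> _]]] := simplex_facets.
by move=> x x0 i si; exact/ltW/x0.
Qed.

Lemma closed_hull : closed (conv_hull X s).
Proof. by have [a [b [_ -> _]]] := simplex_facets; exact: closed_simplex. Qed.

(** The points of the hull that are left out lie on the finitely many hyperplanes where a
    barycentric coordinate vanishes. *)
Lemma ae_hull_open_simplex :
  {ae lebesgue_rV R d, forall x, conv_hull X s x -> open_simplex X s x}.
Proof.
have [a [b [-> -> a0]]] := simplex_facets.
have mH i : measurable [set x | dot x (a i) = - b i].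
  rewrite (_ : mkset _ = (fun x => dot x (a i)) @^-1` [set - b i])//.
  by rewrite -[X in measurable X]setTI; exact: measurable_dot.
have : {ae lebesgue_rV R d, forall x, forall i, i \in s -> dot x (a i) <> - b i}.
  apply: (@filter_forall _ _ (fun i x => i \in s -> dot x (a i) <> - b i)
    (almost_everywhere (lebesgue_rV R d))) => i.
  have [si|si] := boolP (i \in s); last exact: aeW.
  exists [set x | dot x (a i) = - b i]; split => //; first exact: hyperplane_null (a0 i si).
  by move=> x /= /not_implyP[_ /contrapT].
apply: filterS => x nx x0 i si; rewrite lt_neqAle x0// andbT eq_sym.
by apply/eqP => xi; apply: (nx i si); apply/eqP; rewrite -addr_eq0 xi.
Qed.

Lemma bounded_hull : bounded_set (conv_hull X s).
Proof.
exists (\sum_(i in s) `|X i|); split; first exact: num_real.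
move=> M HM x [c [c0 c1 ->]]; apply: le_trans (ltW HM).
apply: le_trans (ler_norm_sum _ _ _) _; apply: ler_sum => i si.
rewrite normrZ ger0_norm//; apply: ler_piMl => //.
by rewrite -c1 (bigD1 i)//= lerDl sumr_ge0.
Qed.

Lemma open_simplex_cutoff : exists chi : nat -> 'rV[R]_d -> R,
  [/\ forall m, smooth (chi m), forall m x, 0 <= chi m x <= 1,
      forall m, closure [set x | chi m x != 0] `<=` open_simplex X s &
      forall x, open_simplex X s x -> chi ^~ x @ \oo --> (1 : R)].
Proof.
have [a [b [-> _ _]]] := simplex_facets.
(* The shift by [-1] makes the cutoff vanish as soon as some barycentric coordinate is at most
   [m.+1%:R^-1], which keeps the closed support off the facets; the factor [m.+1%:R] sends the
   argument to infinity, where [h] tends to [1]. *)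
pose l m i x : R := dot x (m.+1%:R *: a i) + (m.+1%:R * b i - 1).
have lE m i x : l m i x = m.+1%:R * (dot x (a i) + b i) - 1.
  rewrite /l (_ : dot x _ = m.+1%:R * dot x (a i)); first by ring.
  by rewrite /dot big_distrr/=; apply: eq_bigr => j _; rewrite mxE mulrCA.
pose h := @exp_cutoff R 1.
have hE t : h t = if 0 < t then expR (- t^-1) else 0.
  by rewrite /h /exp_cutoff hornerC mul1r.
have h01 t : 0 <= h t <= 1.
  rewrite hE; case: ifPn => t0; rewrite ?lexx ?ler01// expR_ge0 -expR0 ler_expR.
  by rewrite oppr_le0 invr_ge0 ltW.
exists (fun m x => \prod_(i in s) h (l m i x)); split.
- move=> m; apply: smooth_prod => i si.
  apply: (@smooth_comp_affine _ _ (fun k => exp_cutoff (iter k (fun P => 'X^2 * (P - P^`())) 1))).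
  by move=> k t; rewrite iterS; exact: is_derive_exp_cutoff.
- move=> m x; apply/andP; split; first by apply: prodr_ge0 => i _; case/andP: (h01 (l m i x)).
  rewrite [leRHS](_ : 1 = \prod_(i in s) (1 : R)); last by rewrite big1.
  by apply: ler_prod => i _.
- move=> m; pose K := [set x | forall i, i \in s -> m.+1%:R^-1 <= dot x (a i) + b i].
  have m0 : 0 < m.+1%:R :> R by rewrite ltr0n.
  apply: (@subset_trans _ K); last by move=> x Kx i si; apply: lt_le_trans (Kx i si); rewrite invr_gt0.
  rewrite [X in _ `<=` X](closure_id K).1; last exact: closed_simplex.
  apply: closureS => x /= /prodf_neq0 x0 i si; have := x0 i si.
  rewrite hE; case: ifPn; last by rewrite eqxx.
  by rewrite lE subr_gt0 => /ltW; rewrite -ler_pdivrMl// mulr1.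
- move=> x x0; rewrite [X in _ --> X](_ : 1 = \prod_(i in s) (1 : R)); last by rewrite big1.
  apply: cvg_big => [|i si]; first exact: mul_continuous.
  apply/cvgrPdist_le => e e0; have li0 := x0 i si.
  (* From this rank on, [t = l m i x] is at least [e^-1], and then
     [1 - expR (- t^-1) <= t^-1 <= e]. *)
  have := nbhs_infty_ger ((e^-1 + 1) / (dot x (a i) + b i)).
  apply: filterS => m; rewrite ler_pdivrMr// => Hm.
  have ei0 : 0 < e^-1 by rewrite invr_gt0.
  have tm : e^-1 <= l m i x.
    by rewrite lE lerBrDr (le_trans Hm)// ler_wpM2r ?(ltW li0)// ler_nat.
  have t0 : 0 < l m i x by exact: lt_le_trans tm.
  have := h01 (l m i x) => /andP[_ h1].
  rewrite ger0_norm ?subr_ge0// hE t0 lerBlDl -lerBlDr.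
  apply: le_trans (expR_ge1Dx _); rewrite lerD2l lerN2.
  by rewrite -[leRHS]invrK lef_pV2 ?posrE.
Qed.

End simplex.

(** Weights carried by [s :&: t] are also weights on [s]; by uniqueness they are the positive ones,
    so no vertex of [s] is missing from [t]. *)
Lemma open_simplex_subset (R : realType) (d : nat) (I : finType)
    (X : I -> 'rV[R]_d) (s t : {set I}) x : affinely_independent X s ->
  open_simplex X s x -> conv_hull X (s :&: t) x -> s \subset t.
Proof.
move=> ind [c [c0 c1 cx]] [c' [_ c'1 c'x]]; apply/fintype.subsetP => i si.
pose e j : R := if j \in t then c' j else 0.
have ce : c i = e i.
  apply: (affinely_independent_inj ind) si.
    rewrite c1 -c'1; under eq_bigl do rewrite inE.
    by rewrite big_mkcondr; apply: eq_bigr => j _.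
  rewrite -cx c'x; under eq_bigl do rewrite inE.
  rewrite big_mkcondr; apply: eq_bigr => j _; rewrite /e; case: ifP => //.
  by rewrite scale0r.
by have := c0 i si; rewrite ce /e; case: ifP => //; rewrite ltxx.
Qed.

(** * Square-integrable and test functions *)

Lemma Rintegral_sum d (T : measurableType d) (R : realType)
    (mu : {measure set T -> \bar R}) (D : set T) (I : Type) (s : seq I) (P : pred I)
    (f : I -> T -> R) : measurable D ->
  (forall i, P i -> mu.-integrable D (EFin \o f i)) ->
  \int[mu]_(x in D) (\sum_(i <- s | P i) f i x) = \sum_(i <- s | P i) \int[mu]_(x in D) f i x.
Proof.
move=> mD intf; elim: s => [|i s IH].
  by under eq_Rintegral do rewrite big_nil; rewrite big_nil /Rintegral integral0.
under eq_Rintegral do rewrite big_cons; rewrite big_cons.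
have [Pi|_] := boolP (P i); last exact: IH.
rewrite RintegralD ?IH//; first exact: intf.
rewrite (_ : _ \o _ = (fun x => \sum_(j <- s | P j) (EFin \o f j) x)%E).
  by apply: integrable_sum => // j Pj; exact: intf.
by apply/funext => x /=; rewrite sumEFin.
Qed.

Lemma ae_eq_Rintegral d (T : measurableType d) (R : realType)
    (mu : {measure set T -> \bar R}) (D : set T) (f g : T -> R) :
  measurable D -> measurable_fun D f -> measurable_fun D g ->
  {ae mu, forall x, D x -> f x = g x} ->
  \int[mu]_(x in D) f x = \int[mu]_(x in D) g x.
Proof.
move=> mD mf mg fg; rewrite /Rintegral; congr fine; apply: ae_eq_integral => //.
- exact/measurable_EFinP.
- exact/measurable_EFinP.
- by apply: filterS fg => x fg /fg ->.
Qed.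

Lemma mx_coord_le (R : realType) n (x : 'rV[R]_n) i : `|x ord0 i| <= `|x|.
Proof.
rewrite [leRHS]mx_normrE; exact: (le_bigmax _ (fun ij => `|x ij.1 ij.2|) (ord0, i)).
Qed.

Section square_integrable.
Context (R : realType) (d : nat) (Omega : set 'rV[R]_d).
Local Notation mu := (lebesgue_rV R d).
Hypotheses (mO : measurable Omega) (fO : (mu Omega < +oo)%E).
Implicit Types f g : 'rV[R]_d -> R.

Lemma L2E f : L2 Omega f <-> f \_ Omega \in Lfun mu 2%:E.
Proof.
split => [[mf nf]|].
  rewrite inE; apply/andP; split; rewrite inE//=.
  exact/(measurable_restrictT _ mO).
rewrite inE => /andP[]; rewrite !inE/= => mf nf; split => //.
exact/(measurable_restrictT _ mO).
Qed.

Lemma integrable_L2M f g : L2 Omega f -> L2 Omega g ->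
  mu.-integrable Omega (EFin \o (fun x => f x * g x)).
Proof.
move=> /L2E f2 /L2E g2; have /Lfun1_integrable := Lfun2_mul_Lfun1 f2 g2.
move=> h; apply/(integrable_mkcond _ mO); apply: eq_integrable h => // x _ /=.
by rewrite !patchE; case: ifPn => // _; rewrite mulr0.
Qed.

Lemma L2D f g : L2 Omega f -> L2 Omega g -> L2 Omega (fun x => f x + g x).
Proof.
move=> /L2E f2 /L2E g2; apply/L2E.
have /= := (@Lfun_addr_closed _ _ _ mu 2%:E (ltac:(by rewrite lee_fin ler1n))).2 _ _ f2 g2.
rewrite (_ : _ + _ = (fun x => f x + g x) \_ Omega)//.
apply/funext => x; rewrite fctE !patchE; case: ifPn => // _; exact: addr0.
Qed.

Lemma L2N f : L2 Omega f -> L2 Omega (fun x => - f x).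
Proof.
move=> /L2E f2; apply/L2E; have := Lfun_oppr_closed f2.
rewrite (_ : - _ = (fun x => - f x) \_ Omega)//.
by apply/funext => x; rewrite fctE !patchE; case: ifPn => // _; exact: oppr0.
Qed.

Lemma L2B f g : L2 Omega f -> L2 Omega g -> L2 Omega (fun x => f x - g x).
Proof. by move=> f2 g2; apply: L2D => //; exact: L2N. Qed.

Lemma L2_bounded f (C : R) : measurable_fun Omega f ->
  (forall x, Omega x -> `|f x| <= C) -> L2 Omega f.
Proof.
move=> mf fC; split => //; rewrite /finite_norm unlock; apply: poweR_lty.
rewrite (_ : (fun x => _) = (fun x => (f x ^+ 2)%:E) \_ Omega); last first.
  apply/funext => x; rewrite /= !patchE; case: ifPn => _ /=.
    by rewrite powR_mulrn// real_normK// num_real.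
  by rewrite normr0 powR0// pnatr_eq0.
rewrite -integral_mkcond; apply: integrable_lty => //.
apply: measurable_bounded_integrable => //; first exact: measurable_funX.
exists (C ^+ 2); split; first exact: num_real.
move=> y Cy x Ox /=; rewrite (le_trans _ (ltW Cy))// normrX lerXn2r ?nnegrE//.
  by rewrite (le_trans _ (fC x Ox)).
exact: fC.
Qed.

Lemma L2_sum (I : Type) (s : seq I) (f : I -> 'rV[R]_d -> R) :
  (forall i, L2 Omega (f i)) -> L2 Omega (fun x => \sum_(i <- s) f i x).
Proof.
move=> f2; elim: s => [|i s IH].
  under eq_fun do rewrite big_nil; apply: (@L2_bounded _ 0); first exact: measurable_cst.
  by move=> x _; rewrite normr0.
under eq_fun do rewrite big_cons; exact: L2D.
Qed.

Lemma L2_cst (c : R) : L2 Omega (fun=> c).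
Proof. by apply: (@L2_bounded _ `|c|). Qed.

Lemma integrable_L2 f : L2 Omega f -> mu.-integrable Omega (EFin \o f).
Proof.
move=> f2; have := integrable_L2M f2 (L2_cst 1).
by apply: eq_integrable => // x _ /=; rewrite mulr1.
Qed.

End square_integrable.

(** * Test functions and the mean of gradients *)

Section test_functions.
Context (R : realType) (d : nat) (Omega : set 'rV[R]_d).
Local Notation mu := (lebesgue_rV R d).
Implicit Types f g phi psi : 'rV[R]_d -> R.

Lemma test_funM phi psi : smooth phi -> test_fun Omega psi ->
  test_fun Omega (fun x => phi x * psi x).
Proof.
move=> sphi [spsi cS SO].
have sub : closure [set x | phi x * psi x != 0] `<=` closure [set x | psi x != 0].
  by apply: closureS => x /=; apply: contra_neq => ->; rewrite mulr0.
split; first exact: smoothM.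
  by apply: subclosed_compact sub; [exact: closed_closure|].
exact: subset_trans sub SO.
Qed.

Lemma grad_eq0_off_support phi x i :
  ~ closure [set x | phi x != 0] x -> grad phi x ord0 i = 0.
Proof.
move=> nS; rewrite mxE -(derive_cst (0 : R) x (basis_vec R i)).
apply: near_eq_derive.
have : nbhs x (~` closure [set x | phi x != 0]).
  by apply: open_nbhs_nbhs; split => //; exact/closed_openC/closed_closure.
apply: (@filterS _ (nbhs x)) => y nSy; apply: contrapT => /eqP py; apply: nSy.
exact: subset_closure.
Qed.

Lemma bounded_compact_support g (S : set 'rV[R]_d) : continuous g -> compact S ->
  (forall x, ~ S x -> g x = 0) -> exists C : R, forall x, `|g x| <= C.
Proof.
move=> cg cS g0.
have /compact_bounded[M [_ HM]] : compact (g @` S).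
  by apply: continuous_compact => //; exact: continuous_subspaceT.
exists (`|M| + 1) => x; have [Sx|nSx] := pselect (S x); last first.
  by rewrite g0// normr0; have := normr_ge0 M; lra.
by apply: HM; [have := ler_norm M; lra|exists x].
Qed.

Lemma test_fun_bounded phi : test_fun Omega phi -> exists C : R, forall x, `|phi x| <= C.
Proof.
move=> [sphi cS _]; apply: (bounded_compact_support (smooth_continuous sphi) cS).
by move=> x nS; apply: contrapT => /eqP px; apply: nS; exact: subset_closure.
Qed.

Lemma test_fun_grad_bounded phi i : test_fun Omega phi ->
  exists C : R, forall x, `|grad phi x ord0 i| <= C.
Proof.
move=> [sphi cS _]; apply: (bounded_compact_support _ cS).
  exact/smooth_continuous/smooth_grad.
by move=> x; exact: grad_eq0_off_support.
Qed.

Lemma integral_grad_test_fun phi i : measurable Omega -> test_fun Omega phi ->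
  \int[mu]_(x in Omega) grad phi x ord0 i = 0.
Proof.
move=> mO tphi; have [sphi cS SO] := tphi.
rewrite Rintegral_mkcond (_ : _ \_ _ = fun x => grad phi x ord0 i); last first.
  apply/funext => x; rewrite patchE; case: ifPn => //; rewrite notin_setE => nO.
  by rewrite grad_eq0_off_support// => /SO.
have [C HC] := test_fun_grad_bounded i tphi.
have [M [_ HM]] := compact_bounded cS.
have out (x : 'rV[R]_d) : (exists j, M + 1 < `|x ord0 j|) -> ~ closure [set x | phi x != 0] x.
  move=> [j xj] /(HM (M + 1) (ltr_pwDr ltr01 (lexx _))) /=.
  by apply/negP; rewrite -ltNge (lt_le_trans xj)// mx_coord_le.
rewrite /Rintegral; suff -> : (\int[mu]_x (grad phi x ord0 i)%:E = 0)%E by [].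
apply: (@integral_partial_eq0 _ _ i phi _ (M + 1) C) => //.
- exact/smooth_continuous/smooth_grad.
- by move=> x; exact: smooth_is_derive.
- move=> x /out nS; apply: contrapT => /eqP px; apply: nS; exact: subset_closure.
- by move=> x /out; exact: grad_eq0_off_support.
Qed.

Hypotheses (mO : measurable Omega) (fO : (mu Omega < +oo)%E).

Lemma test_fun_L2 phi : test_fun Omega phi -> L2 Omega phi.
Proof.
move=> tphi; have [C HC] := test_fun_bounded tphi; have [sphi _ _] := tphi.
apply: (L2_bounded mO fO (C := C)) => //.
exact: measurable_funTS (continuous_measurable_rV (smooth_continuous sphi)).
Qed.

Lemma test_fun_grad_L2 phi : test_fun Omega phi -> L2v Omega (grad phi).
Proof.
move=> tphi i; have [C HC] := test_fun_grad_bounded i tphi; have [sphi _ _] := tphi.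
apply: (L2_bounded mO fO (C := C)) => //.
exact: measurable_funTS (continuous_measurable_rV (smooth_continuous (smooth_grad i sphi))).
Qed.

Lemma ipvE u v : L2v Omega u -> L2v Omega v ->
  ipv Omega u v = \sum_i ip Omega (fun x => u x ord0 i) (fun x => v x ord0 i).
Proof.
move=> u2 v2; rewrite /ipv /ip /dot Rintegral_sum// => i _.
exact: integrable_L2M.
Qed.

(** On a set of finite measure the mean is continuous for the [L^2] norm, so the zero means of the
    gradients of test functions pass to the limit. *)
Lemma H10_integral_grad f : H10 Omega f ->
  exists2 G, is_grad Omega f G & forall i, \int[mu]_(x in Omega) G x ord0 i = 0.
Proof.
move=> [f2 [G dG approx]]; exists G => // i; have [G2 _] := dG.
set m := fine (mu Omega); have m0 : 0 <= m by exact: fine_ge0.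
have mE : \int[mu]_(x in Omega) 1 = m by rewrite Rintegral_cst// mul1r.
(* AM-GM: |y| <= r + y^2 / (4 r), applied with r = e. *)
have H (e : R) : 0 < e -> `|\int[mu]_(x in Omega) G x ord0 i| <= e * m + e.
  (* This tolerance brings the quadratic term, with its factor [(4 * e)^-1], down to at most [e]. *)
  move=> e0; have [phi tphi Hphi] := approx (4 * e ^+ 2) (ltac:(by rewrite mulr_gt0 ?exprn_gt0)).
  have gphi2 := test_fun_grad_L2 tphi.
  pose y x := G x ord0 i - grad phi x ord0 i.
  have iG := integrable_L2 mO fO (G2 i).
  have igp := integrable_L2 mO fO (gphi2 i).
  have -> : \int[mu]_(x in Omega) G x ord0 i = \int[mu]_(x in Omega) y x.
    by rewrite RintegralB// integral_grad_test_fun// subr0.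
  have y2 j : L2 Omega (fun x => G x ord0 j - grad phi x ord0 j) by exact: L2B.
  have iy : mu.-integrable Omega (EFin \o y) by exact/integrable_L2/y2.
  have iyy j : mu.-integrable Omega (EFin \o (fun x => (G x ord0 j - grad phi x ord0 j) ^+ 2)).
    by apply: eq_integrable (integrable_L2M mO (y2 j) (y2 j)) => // x _; rewrite /= expr2.
  have fp2 : L2 Omega (fun x => f x - phi x) by apply: L2B => //; exact: test_fun_L2.
  have enE x : enorm (G x - grad phi x) ^+ 2 = \sum_j (G x ord0 j - grad phi x ord0 j) ^+ 2.
    rewrite /enorm sqr_sqrtr ?sumr_ge0// => [|j _]; last by rewrite -expr2 sqr_ge0.
    by rewrite /dot; apply: eq_bigr => j _; rewrite !mxE expr2.
  have iyy4 : mu.-integrable Omega (EFin \o (fun x => (4 * e)^-1 * y x ^+ 2)).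
    by apply: eq_integrable (integrableZl mO (4 * e)^-1 (iyy i)).
  have ie : mu.-integrable Omega (EFin \o (fun=> e)) by apply: integrable_L2 => //; exact: L2_cst.
  apply: (le_trans (le_normr_Rintegral mO iy)).
  apply: (@le_trans _ _ (\int[mu]_(x in Omega) (e + (4 * e)^-1 * y x ^+ 2))).
    apply: le_Rintegral => //; first exact: integrable_norm.
      by apply: eq_integrable (integrableD mO ie iyy4).
    move=> x _; rewrite -lerBlDl mulrC ler_pdivlMr ?mulr_gt0//.
    have := sqr_ge0 (`|y x| - 2 * e); have := real_normK (num_real (y x)); nra.
  rewrite RintegralD// Rintegral_cst// lerD2l.
  rewrite RintegralZl//; last exact: iyy.
  rewrite mulrC ler_pdivrMr ?mulr_gt0// (_ : e * (4 * e) = 4 * e ^+ 2); last by ring.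
  apply: le_trans (ltW Hphi).
  apply: le_Rintegral => //; first exact: iyy.
    apply: (@eq_integrable _ _ _ _ _ mO (fun x => ((f x - phi x) * (f x - phi x))%:E +
        (\sum_j ((G x ord0 j - grad phi x ord0 j) ^+ 2)%:E))%E).
      by move=> x _; rewrite /= sumEFin -EFinD enE expr2.
    apply: integrableD => //; first exact: integrable_L2M.
    by apply: integrable_sum => // j _; exact: iyy.
  move=> x _; rewrite enE (bigD1 i)//= -/(y x) addrCA lerDl addr_ge0 ?sqr_ge0//.
  by apply: sumr_ge0 => j _; exact: sqr_ge0.
apply/eqP; rewrite -normr_eq0 eq_le normr_ge0 andbT.
apply/ler_addgt0Pr => e e0; rewrite add0r.
have m1 : 0 < m + 1 by lra.
have := H (e / (m + 1)) (divr_gt0 e0 m1).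
by rewrite -{2}[e / (m + 1)]mulr1 -mulrDr divfK// gt_eqF.
Qed.

End test_functions.

(** * Weak divergences of locally affine fields *)

Lemma Rintegral_cvg_eq0 d (T : measurableType d) (R : realType)
    (mu : {measure set T -> \bar R}) (D : set T) (F : nat -> T -> R) (f g : T -> R) :
  measurable D -> (forall m, measurable_fun D (F m)) -> measurable_fun D f ->
  (forall x, D x -> F ^~ x @ \oo --> f x) -> mu.-integrable D (EFin \o g) ->
  (forall m x, D x -> `|F m x| <= g x) ->
  (forall m, \int[mu]_(x in D) F m x = 0) -> \int[mu]_(x in D) f x = 0.
Proof.
move=> mD mF mf Ff ig Fg F0.
have iF m : mu.-integrable D (EFin \o F m).
  apply: le_integrable ig => //; first exact/measurable_EFinP.
  by move=> x Dx; rewrite lee_fin (le_trans (Fg m x Dx))// ler_norm.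
have F0' m : (\int[mu]_(x in D) (F m x)%:E = 0)%E.
  by rewrite -(fineK (integrable_fin_num mD (iF m))); exact: (congr1 EFin (F0 m)).
have mF' m : measurable_fun D (EFin \o F m) by exact/measurable_EFinP.
have mf' : measurable_fun D (EFin \o f) by exact/measurable_EFinP.
have Ff' : {ae mu, forall x, D x -> (fun m => (F m x)%:E) @ \oo --> (f x)%:E}.
  by apply: aeW => x Dx; apply: cvg_EFin; [exact: nearW|exact: Ff].
have Fg' : {ae mu, forall x m, D x -> (`|(F m x)%:E| <= (g x)%:E)%E}.
  by apply: aeW => x m Dx; rewrite lee_fin Fg.
have [_ _] := dominated_convergence mD mF' mf' Ff' ig Fg'.
under eq_fun do rewrite F0'; rewrite /= => /cvg_lim -/(_ (@ereal_hausdorff _)).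
by rewrite lim_cst ?/Rintegral//= => <-.
Qed.

Lemma affine_coordE (R : realType) d (A : 'M[R]_d) (b x : 'rV[R]_d) i :
  (x *m A + b) ord0 i = dot x (\row_j A j i) + b ord0 i.
Proof. by rewrite !mxE /dot; congr (_ + _); apply: eq_bigr => j _; rewrite mxE. Qed.

Section weak_divergence.
Context (R : realType) (d : nat) (Omega : set 'rV[R]_d).
Local Notation mu := (lebesgue_rV R d).
Hypotheses (mO : measurable Omega) (fO : (mu Omega < +oo)%E).

Lemma L2_dot u phi : L2v Omega u -> test_fun Omega phi ->
  mu.-integrable Omega (EFin \o (fun x => dot (u x) (grad phi x))).
Proof.
move=> u2 tphi.
apply: (@eq_integrable _ _ _ _ _ mO (fun x => \sum_i (u x ord0 i * grad phi x ord0 i)%:E)%E).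
  by move=> x _; rewrite /= sumEFin.
apply: integrable_sum => // i _; apply: integrable_L2M => //.
exact: test_fun_grad_L2.
Qed.

Lemma is_divD u v w w' : is_div Omega u w -> is_div Omega v w' ->
  is_div Omega (u \+ v) (fun x => w x + w' x).
Proof.
move=> [u2 w2 uw] [v2 w'2 vw']; split.
- move=> i; under eq_fun do rewrite mxE; exact: L2D.
- exact: L2D.
move=> phi tphi; have phi2 := test_fun_L2 mO fO tphi.
transitivity (ipv Omega u (grad phi) + ipv Omega v (grad phi)).
  rewrite /ipv -RintegralD//; [|exact: L2_dot|exact: L2_dot].
  by apply: eq_Rintegral => x _; rewrite dotDl.
rewrite uw// vw'// -opprD; congr (- _).
rewrite /ip -RintegralD//; [|exact: integrable_L2M|exact: integrable_L2M].
by apply: eq_Rintegral => x _; rewrite mulrDl.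
Qed.

Lemma is_div_grad v (G : 'I_d -> 'rV[R]_d -> 'rV[R]_d) : L2v Omega v ->
  (forall i, is_grad Omega (fun x => v x ord0 i) (G i)) ->
  is_div Omega v (fun x => \sum_i G i x ord0 i).
Proof.
move=> v2 vG; have G2 i : L2 Omega (fun x => G i x ord0 i) by exact: (vG i).1.
split => //; first exact: L2_sum.
move=> phi tphi; rewrite (ipvE mO)//; last exact: test_fun_grad_L2.
under eq_bigr do rewrite (vG _).2//.
rewrite sumrN /ip -Rintegral_sum//.
  by congr (- _); apply: eq_Rintegral => x _; rewrite mulr_suml.
by move=> i _; apply: integrable_L2M => //; exact: test_fun_L2.
Qed.

(** No boundary term arises: each component of the affine field times [psi] is itself a test
    function, whose partial derivative has zero mean, and the product rule leaves the diagonal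
    entries of [A]. *)
Lemma integral_affine_grad (A : 'M[R]_d) (b : 'rV[R]_d) psi : test_fun Omega psi ->
  \int[mu]_(x in Omega) dot (x *m A + b) (grad psi x) =
  - (\tr A * \int[mu]_(x in Omega) psi x).
Proof.
move=> tpsi; have [spsi _ _] := tpsi.
pose l i (x : 'rV[R]_d) := dot x (\row_j A j i) + b ord0 i.
have lE i x : (x *m A + b) ord0 i = l i x by exact: affine_coordE.
have sl i : smooth (l i).
  (* The successive derivatives of the identity: [id], [1], then [0] forever. *)
  apply: (@smooth_comp_affine _ _ (fun k => if k is k'.+1 then cst (k' == 0%N)%:R else id)).
  by move=> [|k] s; [exact: is_derive_id|exact: is_derive_cst].
have tl i : test_fun Omega (fun x => l i x * psi x) by exact: test_funM.
have dl i x : is_derive x (basis_vec R i) (l i) (A i i).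
  apply: (is_derive_line (f := id) (c := l i) (w := A i i)) => h.
  by rewrite /l dotDl dotZl dot_basis_vec mxE addrA.
have gE i x : grad (fun x => l i x * psi x) x ord0 i =
    l i x * grad psi x ord0 i + A i i * psi x.
  have [_ dv] := is_deriveM (dl i x) (smooth_is_derive i x spsi).
  by rewrite [LHS]mxE [LHS]dv /GRing.scale/= [psi x * _]mulrC.
have E x : dot (x *m A + b) (grad psi x) =
    \sum_i grad (fun x => l i x * psi x) x ord0 i - \tr A * psi x.
  under eq_bigr do rewrite gE.
  rewrite big_split/= /mxtrace mulr_suml addrK.
  by apply: eq_bigr => i _; rewrite lE.
under eq_Rintegral do rewrite E.
have gl2 i := test_fun_grad_L2 mO fO (tl i) i.
have psi2 := test_fun_L2 mO fO tpsi.
have ipsi := integrable_L2 mO fO psi2.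
rewrite RintegralB//.
- rewrite Rintegral_sum//; last by move=> i _; exact: integrable_L2.
  rewrite big1 => [|i _]; last exact: integral_grad_test_fun.
  by rewrite sub0r RintegralZl.
- by apply: integrable_L2 => //; exact: L2_sum.
- exact: eq_integrable (integrableZl mO (\tr A) ipsi).
Qed.

Lemma integrable_mul_indic (f : 'rV[R]_d -> R) (S : set 'rV[R]_d) : measurable S ->
  mu.-integrable Omega (EFin \o f) ->
  mu.-integrable Omega (EFin \o (fun x => f x * \1_S x)).
Proof.
move=> mS intf; apply: le_integrable (intf) => //.
  apply/measurable_EFinP/measurable_funM.
    by case/integrableP: intf => /measurable_EFinP mf _; exact: mf.
  exact: measurable_funTS (measurable_indic mS).
move=> x _; rewrite lee_fin normrM indicE; case: (_ \in _); rewrite ?normr1 ?mulr1//.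
by rewrite normr0 mulr0.
Qed.

Section element.
Context (I : finType) (X : I -> 'rV[R]_d) (s : {set I}).
Hypotheses (d_gt0 : (0 < d)%N) (card_s : #|s| = d.+1).
Hypothesis ind_s : affinely_independent X s.
Hypothesis sO : open_simplex X s `<=` Omega.

Let mS : measurable (open_simplex X s).
Proof. by apply: open_measurable_rV; exact: open_open_simplex. Qed.

(** The cutoff must be removed only after the integration by parts: the gradient of [chi m] admits
    no uniform bound near the facets, but the identity obtained for each [m] contains [chi m] alone,
    which stays between [0] and [1]. *)
Lemma is_div_affine v w (A : 'M[R]_d) (b : 'rV[R]_d) phi : is_div Omega v w ->
  ae_in (conv_hull X s) (fun x => v x = x *m A + b) ->
  smooth phi -> L2 Omega phi ->
  \int[mu]_(x in Omega) (w x * phi x * \1_(open_simplex X s) x) =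
  \tr A * \int[mu]_(x in Omega) (phi x * \1_(open_simplex X s) x).
Proof.
move=> [v2 w2 vw] vA sphi phi2; set S := open_simplex X s.
have [chi [schi chi01 chiS chi1]] := open_simplex_cutoff d_gt0 card_s ind_s.
have chi0 m x : ~ S x -> chi m x = 0.
  move=> nS; apply: contrapT => /eqP cx; apply: nS; apply: (chiS m).
  exact: subset_closure.
have tchi m : test_fun Omega (chi m).
  split => //; last exact: subset_trans (chiS m) sO.
  apply: (@subclosed_compact _ _ (conv_hull X s)); first exact: closed_closure.
    apply: bounded_closed_compact; first exact: bounded_hull.
    exact: closed_hull.
  apply: subset_trans (chiS m) _; exact: open_simplex_sub_hull.
pose psi m x := phi x * chi m x.
have tpsi m : test_fun Omega (psi m) by exact: test_funM.
have iwp := integrable_L2M mO w2 phi2.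
have ip := integrable_L2 mO fO phi2.
have iAp : mu.-integrable Omega (EFin \o (fun x => \tr A * phi x)).
  exact: eq_integrable (integrableZl mO (\tr A) ip).
pose g x := (w x * phi x - \tr A * phi x).
have ig : mu.-integrable Omega (EFin \o g).
  exact: eq_integrable (integrableB mO iwp iAp).
have mg : measurable_fun Omega g by case/integrableP : ig => /measurable_EFinP.
have g0 m : \int[mu]_(x in Omega) (g x * chi m x) = 0.
  have psi2 := test_fun_L2 mO fO (tpsi m).
  have := integral_affine_grad A b (tpsi m).
  rewrite -(@ae_eq_Rintegral _ _ _ _ _ (fun x => dot (v x) (grad (psi m) x)))//.
  - rewrite -/(ipv _ _ _) vw// => /oppr_inj vwA.
    transitivity (\int[mu]_(x in Omega) (w x * psi m x - \tr A * psi m x)).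
      by apply: eq_Rintegral => x _; rewrite /g /psi mulrBl !mulrA.
    rewrite RintegralB//.
    + rewrite -/(Defs.ip _ _ _) vwA RintegralZl ?subrr//; exact: integrable_L2.
    + exact: integrable_L2M.
    + exact: eq_integrable (integrableZl mO (\tr A) (integrable_L2 mO fO psi2)).
  - by case/integrableP : (L2_dot v2 (tpsi m)) => /measurable_EFinP.
  - apply: measurable_sum => i; apply: measurable_funM; last first.
      exact: (test_fun_grad_L2 mO fO (tpsi m) i).1.
    under eq_fun do rewrite affine_coordE.
    by apply/measurable_funTS/measurable_funD => //; exact: measurable_dot.
  (* The field is affine on the hull only; off the hull the gradient of [psi m] vanishes. *)
  - move: vA; apply: (@filterS _ (almost_everywhere mu)) => x vA Ox.
    have [hx|nhx] := pselect (conv_hull X s x); first by rewrite vA.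
    have gr0 i : grad (psi m) x ord0 i = 0.
      apply: grad_eq0_off_support => cx; apply: nhx; apply: open_simplex_sub_hull => //.
      apply: (chiS m); apply: closureS cx => y /=; apply: contra_neq => cy.
      by rewrite /psi cy mulr0.
    by rewrite /dot !big1// => i _; rewrite gr0 mulr0.
have gS : \int[mu]_(x in Omega) (g x * \1_S x) = 0.
  apply: (@Rintegral_cvg_eq0 _ _ _ _ _ (fun m x => g x * chi m x) _ (fun x => `|g x|)) => //.
  - move=> m; apply: measurable_funM => //.
    exact: measurable_funTS (continuous_measurable_rV (smooth_continuous (schi m))).
  - by apply: measurable_funM => //; exact: measurable_funTS (measurable_indic mS).
  - move=> x _; apply: cvgM; first exact: cvg_cst.
    rewrite indicE; have [Sx|nSx] := pselect (S x); first by rewrite mem_set//; exact: chi1.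
    rewrite memNset//; under eq_fun do rewrite chi0//; exact: cvg_cst.
  - exact: integrable_norm.
  - move=> m x _; rewrite normrM; apply: ler_piMr => //.
    by have /andP[c0 c1] := chi01 m x; rewrite ger0_norm.
apply/eqP; rewrite -subr_eq0; apply/eqP; rewrite -[RHS]gS.
rewrite -RintegralZl//; last exact: integrable_mul_indic.
rewrite -RintegralB//.
- by apply: eq_Rintegral => x _; rewrite /g; ring.
- exact: integrable_mul_indic.
- by apply: eq_integrable (integrableZl mO (\tr A) (integrable_mul_indic mS ip)).
Qed.

End element.
End weak_divergence.

(** * Piecewise constant divergences *)

Lemma bounded_rV_finite (R : realType) d (Omega : set 'rV[R]_d) :
  measurable Omega -> bounded_set Omega -> (lebesgue_rV R d Omega < +oo)%E.
Proof.
move=> mO [M [_ HM]]; apply: le_lt_trans (@sup_box_finite R d (M + 1)).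
apply: le_measure; rewrite ?inE//; first exact: measurable_sup_box.
move=> x Ox i; apply: le_trans (mx_coord_le x i) _.
by apply: HM => //; rewrite ltrDl.
Qed.

Section discrete_divergence.
Context (R : realType) (d : nat) (Omega : set 'rV[R]_d) (Th : triangulation Omega).
Local Notation mu := (lebesgue_rV R d).
Hypotheses (d_gt0 : (0 < d)%N) (dO : polyhedral_lipschitz_domain Omega).
Let S T := open_simplex (@vert _ _ _ Th) T.

Let mO : measurable Omega.
Proof. by case: dO => oO _ _ _ _; exact: open_measurable_rV. Qed.

Let fO : (mu Omega < +oo)%E.
Proof. by case: dO => _ _ _ bO _; exact: bounded_rV_finite. Qed.

Let mS T : T \in elts Th -> measurable (S T).
Proof.
move=> eT; apply: open_measurable_rV; apply: open_open_simplex => //.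
  exact: card_elt.
exact: elt_nondegenerate.
Qed.

(** [elts_cover] sees only the closure of [Omega]; the Lipschitz boundary is what excludes a crack
    running through an element. *)
Lemma open_elt_sub T : T \in elts Th -> S T `<=` Omega.
Proof.
move=> eT; case: dO => oO _ _ _ [lO _].
apply: subset_trans (lipschitz_interior_closure oO lO).
have oS : open (S T).
  by apply: open_open_simplex => //; [exact: card_elt|exact: elt_nondegenerate].
rewrite -open_subsetE// (elts_cover Th).
move=> x Sx; exists T => //; exact: (open_simplex_sub_hull d_gt0 (card_elt eT) (elt_nondegenerate eT)).
Qed.

(** Conformity puts [x] in the hull of the common vertices, which forces [T] into [T']; equal
    cardinals do the rest. *)
Lemma open_elt_unique T T' x : T \in elts Th -> T' \in elts Th ->
  S T x -> conv_hull (@vert _ _ _ Th) T' x -> T = T'.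
Proof.
move=> eT eT' Sx hx; apply/eqP; rewrite eqEcard (card_elt eT) (card_elt eT') leqnn andbT.
apply: (open_simplex_subset (elt_nondegenerate eT) Sx).
rewrite -(elts_conforming eT eT'); split => //.
exact: (open_simplex_sub_hull d_gt0 (card_elt eT) (elt_nondegenerate eT)).
Qed.

Lemma sum_indic_open_elt T x : T \in elts Th -> S T x ->
  forall c : {set 'I_(nb_vert Th)} -> R, \sum_(T' in elts Th) c T' * \1_(S T') x = c T.
Proof.
move=> eT Sx c; rewrite (bigD1 T)//= indicE mem_set// mulr1 big1 ?addr0// => T' /andP[eT' TT'].
rewrite indicE memNset ?mulr0// => Sx'; move/eqP: TT'; apply.
apply/esym/(open_elt_unique eT eT' Sx).
exact: (open_simplex_sub_hull d_gt0 (card_elt eT') (elt_nondegenerate eT')).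
Qed.

Lemma ae_open_elt : {ae mu, forall x, Omega x -> exists2 T, T \in elts Th & S T x}.
Proof.
have : {ae mu, forall x, forall T, T \in elts Th -> conv_hull (@vert _ _ _ Th) T x -> S T x}.
  apply: (@filter_forall _ _ (fun T x => T \in elts Th -> conv_hull (@vert _ _ _ Th) T x -> S T x)
    (almost_everywhere mu)) => T.
  have [eT|_] := boolP (T \in elts Th); last exact: aeW.
  have := ae_hull_open_simplex d_gt0 (card_elt eT) (elt_nondegenerate eT).
  by apply: (@filterS _ (almost_everywhere mu)) => x h _.
apply: (@filterS _ (almost_everywhere mu)) => x h Ox.
have : closure Omega x by exact: subset_closure.
by rewrite (elts_cover Th) => -[T /= eT hx]; exists T => //; exact: h.
Qed.

(** Localisation is by indicators, so that every integral stays over [Omega], as in the weak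
    identities. *)
Lemma integral_sum_elts (g : 'rV[R]_d -> R) : mu.-integrable Omega (EFin \o g) ->
  \int[mu]_(x in Omega) g x =
  \sum_(T in elts Th) \int[mu]_(x in Omega) (g x * \1_(S T) x).
Proof.
move=> ig; have igS T : T \in elts Th -> mu.-integrable Omega (EFin \o (fun x => g x * \1_(S T) x)).
  by move=> eT; apply: integrable_mul_indic => //; exact: mS.
rewrite -Rintegral_sum//; apply: ae_eq_Rintegral => //.
- by case/integrableP: ig => /measurable_EFinP.
- have : mu.-integrable Omega (fun x => \sum_(T in elts Th) (g x * \1_(S T) x)%:E)%E.
    by apply: integrable_sum => // T eT; exact: igS.
  case/integrableP => + _; under eq_fun do rewrite sumEFin.
  by move/measurable_EFinP.
- have := ae_open_elt; apply: (@filterS _ (almost_everywhere mu)) => x h Ox.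
  have [T eT Sx] := h Ox.
  by rewrite (sum_indic_open_elt eT Sx (fun=> g x)).
Qed.

(** The two summands have zero mean for different reasons: the continuous part as an [H^1] limit of
    test functions, the RT0 part by its vanishing normal trace tested against the constant [1]. *)
Lemma Vh_div v : Vh Th v -> exists2 w, is_div Omega v w & \int[mu]_(x in Omega) w x = 0.
Proof.
move=> [v1 [vR [[H1 _] [[[w0 dw0] tr0] _] ->]]].
have /choice[G HG] i : exists G, is_grad Omega (fun x => v1 x ord0 i) G /\
    forall j, \int[mu]_(x in Omega) G x ord0 j = 0.
  by have [G] := H10_integral_grad mO fO (H1 i); exists G.
have v12 : L2v Omega v1 by move=> i; exact: (H1 i).1.
have dv1 := is_div_grad mO fO v12 (fun i => (HG i).1).
have dvR : is_div Omega vR (wdiv Omega vR) by exact: (xgetPex (fun=> 0) (ex_intro _ w0 dw0)).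
have G2 i : L2 Omega (fun x => G i x ord0 i) by exact: (HG i).1.1.
have w2 : L2 Omega (wdiv Omega vR) by case: dvR.
exists (fun x => \sum_i G i x ord0 i + wdiv Omega vR x); first exact: is_divD.
rewrite RintegralD//; [|by apply: integrable_L2 => //; exact: L2_sum|exact: integrable_L2].
rewrite Rintegral_sum//; last by move=> i _; exact: integrable_L2.
rewrite big1 ?add0r => [|i _]; last exact: (HG i).2.
have := tr0 (cst 1) (smooth_cst _ 1); rewrite /normal_trace.
rewrite (_ : ipv _ _ _ = 0) ?add0r => [<-|].
  by apply: eq_Rintegral => x _; rewrite mulr1.
rewrite /ipv (_ : (fun x => _) = fun=> 0); first by rewrite Rintegral_cst// mul0r.
apply/funext => x; apply: big1 => i _.
by rewrite mxE derive_cst mulr0.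
Qed.

Lemma Vh_affine v : Vh Th v -> forall T, T \in elts Th -> exists (A : 'M[R]_d) (b : 'rV[R]_d),
  ae_in (conv_hull (@vert _ _ _ Th) T) (fun x => v x = x *m A + b).
Proof.
move=> [v1 [vR [[_ H1] [_ HR] ->]]] T eT.
have [A [b HA]] := H1 T eT; have [a [c Ha]] := HR T eT.
exists (A + c%:M), (b + a); move: HA Ha.
apply: (@filterS2 _ (almost_everywhere mu)) => x hA ha hx.
rewrite /= hA// ha// mulmxDr mul_mx_scalar.
by rewrite [a + _]addrC addrACA.
Qed.

Lemma Vh_div_eq0 v : Vh Th v -> (forall q, Wh Th q -> form_b Omega v q = 0) ->
  is_div Omega v (fun=> 0).
Proof.
move=> vV vq; have [w dw w0] := Vh_div vV.
have dW : is_div Omega v (wdiv Omega v) by exact: (xgetPex (fun=> 0) (ex_intro _ w dw)).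
move: dW; set W := wdiv Omega v => dW; have [v2 W2 vW] := dW; have [_ w2 _] := dw.
(* The constant is chosen before [u]: it has to serve both the zero-mean [w] and the representative
   [W] that [form_b] uses. *)
have /choice[c Hc] (T : {set 'I_(nb_vert Th)}) : exists c : R, T \in elts Th ->
    forall u phi, is_div Omega v u -> smooth phi -> L2 Omega phi ->
    \int[mu]_(x in Omega) (u x * phi x * \1_(S T) x) =
    c * \int[mu]_(x in Omega) (phi x * \1_(S T) x).
  have [eT|_] := boolP (T \in elts Th); last by exists 0.
  have [A [b HA]] := Vh_affine vV eT; exists (\tr A) => _ u phi du sphi phi2.
  apply: (is_div_affine mO fO d_gt0 (card_elt eT) (elt_nondegenerate eT) _ du HA sphi phi2).
  exact: open_elt_sub.
pose m T := \int[mu]_(x in Omega) \1_(S T) x : R.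
have i1 T : T \in elts Th -> mu.-integrable Omega (EFin \o (\1_(S T) : _ -> R)).
  move=> eT; have := integrable_mul_indic mO (mS eT) (integrable_L2 mO fO (L2_cst mO fO 1)).
  by apply: eq_integrable => // x _; rewrite /= mul1r.
have Hm T u : T \in elts Th -> is_div Omega v u ->
    \int[mu]_(x in Omega) (u x * \1_(S T) x) = c T * m T.
  move=> eT du; have := Hc T eT u (cst 1) du (smooth_cst _ 1) (L2_cst mO fO 1).
  under eq_Rintegral do rewrite mulr1.
  by under [in RHS]eq_Rintegral do rewrite mul1r.
pose q x := \sum_(T in elts Th) c T * \1_(S T) x.
have mq : measurable_fun setT q.
  rewrite /q; under eq_fun do rewrite big_mkcond.
  apply: measurable_sum => T; have [eT|_] := boolP (T \in elts Th); last exact: measurable_cst.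
  by apply: measurable_funM => //; exact: measurable_indic (mS eT).
have q2 : L2 Omega q.
  apply: (@L2_bounded _ _ _ mO fO _ (\sum_(T in elts Th) `|c T|)).
    exact: measurable_funTS mq.
  move=> x _; apply: le_trans (ler_norm_sum _ _ _) _; apply: ler_sum => T _.
  rewrite normrM ler_piMr// indicE; case: (_ \in _); by rewrite ?normr1 ?normr0.
have qW : Wh Th q.
  split; last first.
    move=> T eT; exists (c T).
    have := ae_hull_open_simplex d_gt0 (card_elt eT) (elt_nondegenerate eT).
    apply: (@filterS _ (almost_everywhere mu)) => x h hx.
    exact: (sum_indic_open_elt eT (h hx)).
  (* On each element [q] and [w] have the same integral [c T * m T], so [q] inherits the zero mean
     of [w]. *)
  split => //; rewrite integral_sum_elts; last exact: integrable_L2.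
  rewrite -[RHS]w0 integral_sum_elts; last exact: integrable_L2.
  apply: eq_bigr => T eT; rewrite (Hm T w eT dw) -RintegralZl//; last exact: i1.
  apply: eq_Rintegral => x _; rewrite indicE; case: (boolP (x \in S T)); last by rewrite !mulr0.
  by move=> /set_mem Sx; rewrite !mulr1 /q (sum_indic_open_elt eT Sx).
have m0 T : 0 <= m T by apply: Rintegral_ge0 => x _.
have cm T : T \in elts Th -> c T = 0 \/ m T = 0.
  (* This is the second equation tested with [q]; all its terms are nonnegative. *)
  have : \sum_(T in elts Th) c T ^+ 2 * m T = 0.
    rewrite -[RHS](vq q qW) /form_b /ip -/W integral_sum_elts; last exact: integrable_L2M.
    apply: eq_bigr => {}T eT; rewrite expr2 -mulrA -(Hm T W eT dW).
    rewrite -RintegralZl//; last first.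
      by apply: integrable_mul_indic => //; [exact: mS|exact: integrable_L2].
    apply: eq_Rintegral => x _; rewrite indicE; case: (boolP (x \in S T)); last by rewrite !mulr0.
    by move=> /set_mem Sx; rewrite !mulr1 /q (sum_indic_open_elt eT Sx) mulrC.
  move=> /eqP; rewrite psumr_eq0 => [/allP H eT|T' _]; last by rewrite mulr_ge0 ?sqr_ge0.
  have := H T; rewrite mem_index_enum eT/= => /(_ isT); rewrite mulf_eq0 sqrf_eq0.
  by case/orP => /eqP; [left|right].
split => //; first exact: L2_cst.
move=> phi tphi; have [sphi _ _] := tphi; have phi2 := test_fun_L2 mO fO tphi.
rewrite vW// /ip; congr (- _).
under [RHS]eq_Rintegral do rewrite mul0r.
rewrite Rintegral_cst// mul0r integral_sum_elts; last exact: integrable_L2M.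
apply: big1 => T eT; rewrite (Hc T eT W phi)//.
have [->|mT] := cm T eT; first by rewrite mul0r.
(* On an element with [m T = 0], the integral of [phi] is at most [C * m T] in absolute value. *)
have [C HC] := test_fun_bounded tphi.
have ip1 := integrable_mul_indic mO (mS eT) (integrable_L2 mO fO phi2).
suff -> : \int[mu]_(x in Omega) (phi x * \1_(S T) x) = 0 by rewrite mulr0.
apply/eqP; rewrite -normr_le0; apply: (le_trans (le_normr_Rintegral mO ip1)).
rewrite -(mulr0 C) -mT -RintegralZl//; last exact: i1.
apply: le_Rintegral => //.
- exact: integrable_norm.
- exact: eq_integrable (integrableZl mO C (i1 T eT)).
- by move=> x _; rewrite normrM [`|\1_(S T) x|]ger0_norm// ler_wpM2r.
Qed.

End discrete_divergence.

Theorem theorem2p1 (R : realType) (d : nat) (hd : d = 2%N \/ d = 3%N)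
    (Omega : set 'rV[R]_d) (hOmega : polyhedral_lipschitz_domain Omega)
    (Th : triangulation Omega) (sigma : R) (hTh : shape_regular Th sigma)
    (Phi : {set 'I_(nb_vert Th)} -> 'rV[R]_d -> 'rV[R]_d)
    (hPhi : forall e, e \in interior_faces Th -> RT_basis_fun e (Phi e))
    (alpha : {set 'I_(nb_vert Th)} -> R)
    (halpha : forall T, T \in elts Th -> 0 < alpha T)
    (aR : ('rV[R]_d -> 'rV[R]_d) -> ('rV[R]_d -> 'rV[R]_d) -> R)
    (haR : [\/ aR = form_a0 alpha, aR = form_aD Phi alpha | aR = form_adiv Phi alpha])
    (nu : R) (hnu : 0 < nu)
    (f : 'rV[R]_d -> 'rV[R]_d) (hf : L2v Omega f)
    (uh : 'rV[R]_d -> 'rV[R]_d) (ph : 'rV[R]_d -> R)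
    (hsol : stokes_solution Th aR nu f uh ph) :
  is_div Omega uh (fun=> 0).
Proof.
case: hsol => uV _ _ uq; apply: (@Vh_div_eq0 _ _ _ Th) => //.
by case: hd => ->.
Qed.
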